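(* Suppose Assumption 1 holds. Let $M=I_T-X(X'X)^{-1}X'$ and $\hat\sigma^2=\frac{y'My}{T-K}$. Then $$\frac{\hat\sigma^2}{\sigma^2}=1-\frac{\sigma^2\,\alpha'\bar S^{-1}\alpha}{T-K}\Big(\sum_{t=2}^T\tilde M_{t,t-1}\Big)^2+o_p(1),$$ where $\bar S=\tilde X'\tilde X+\sigma^2(T-K)\,\alpha\alpha'$ and $\tilde M=I_T-\tilde X(\tilde X'\tilde X)^{-1}\tilde X'$.
   Context: Asymptotic framework: all objects may depend on the sample size $T$; limits, $O_p$ and $o_p$ are as $T\to\infty$; $c\in(0,1)$ and $C>0$ denote fixed constants not depending on $T$. Model: $y_t=x_t'\beta+\varepsilon_t$, $t=1,\dots,T$, with $x_t,\beta\in\mathbb R^K$; $y=(y_1,\dots,y_T)'$, $X=[x_1,\dots,x_T]'$ ($T\times K$), $\varepsilon=(\varepsilon_1,\dots,\varepsilon_T)'$. Assumption 1: (i) $x_t=\tilde x_t+\alpha\varepsilon_{t-1}$ for all $t$, where $\tilde X=[\tilde x_1,\dots,\tilde x_T]'$ is $T\times K$ of full column rank $K$; (ii) $\{\varepsilon_t\}_{t=0}^T$ are i.i.d. conditionally on $\tilde X$ with $E[\varepsilon_t\mid\tilde X]=0$, $c<\sigma^2:=E[\varepsilon_t^2\mid\tilde X]<C$ and $E[\varepsilon_t^4\mid\tilde X]<C$ almost surely; (iii) $\alpha,r\in\mathbb R^K$ are non-random with $\alpha'(\tfrac1T\tilde X'\tilde X)^{-1}\alpha=O_p(1)$ and $r'(\tfrac1T\tilde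 X'\tilde X)^{-1}r=O_p(1)$; (iv) $K$ may diverge with $T$ and $K/T<1-c$. *)

(* Defs.v *)
From HB Require Import structures.
From mathcomp Require Import all_boot all_order all_algebra.
From mathcomp Require Import all_classical all_reals all_analysis.
Set Implicit Arguments. Unset Strict Implicit. Unset Printing Implicit Defensive.
Import Order.TTheory GRing.Theory Num.Theory.
Local Open Scope classical_set_scope.
Local Open Scope ring_scope.

Section Defs.
Context {R : realType} {d : measure_display} (Om : nat -> measurableType d).

Definition op1 (P : forall T, probability (Om T) R) (Z : forall T, Om T -> R) : Prop :=
  forall e delta : R, 0 < e -> 0 < delta ->
    exists N : nat, forall T : nat, (N <= T)%N ->
      (P T [set w | (e < `|Z T w|)%R] <= delta%:E)%E.

Definition Op1 (P : forall T, probability (Om T) R) (Z : forall T, Om T -> R) : Prop :=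
  forall delta : R, 0 < delta ->
    exists M : R, exists N : nat, forall T : nat, (N <= T)%N ->
      (P T [set w | (M < `|Z T w|)%R] <= delta%:E)%E.
End Defs.

Section Cond.
Context {R : realType} {d : measure_display} {Om : measurableType d}.

Definition sigma_of_mx (n m : nat) (A : Om -> 'M[R]_(n, m)) : set (set Om) :=
  <<s [set E | exists (i : 'I_n) (j : 'I_m) (B : set R),
          measurable B /\ E = (fun w => A w i j) @^-1` B] >>.

Definition measurable_wrt (G : set (set Om)) (f : Om -> R) : Prop :=
  forall B : set R, measurable B -> G (f @^-1` B).

(** e_0, ..., e_n are i.i.d. conditionally on the sigma-algebra G, with
    (regular) conditional law kappa: kappa w is a probability on R, each
    w |-> kappa w B is G-measurable, and for every A in G and Borel sets
    B_0, ..., B_n,  P(A /\ e_0 in B_0 /\ ... /\ e_n in B_n)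
                      = E[ 1_A * prod_t kappa(B_t) ]. *)
Definition cond_iid (P : probability Om R) (G : set (set Om)) (n : nat)
    (e : 'I_n -> Om -> R) (kappa : Om -> probability R R) : Prop :=
  (forall B : set R, measurable B -> measurable_wrt G (fun w => fine (kappa w B))) /\
  (forall (A : set Om) (B : 'I_n -> set R), G A -> (forall t, measurable (B t)) ->
     P (A `&` [set w | forall t, B t (e t w)])
     = (\int[P]_(w in A) \prod_(t < n) kappa w (B t))%E).
End Cond.

Definition annih {R : fieldType} (n k : nat) (A : 'M[R]_(n, k)) : 'M[R]_n :=
  1%:M - A *m invmx (A^T *m A) *m A^T.

(* Main.v *)
(** Write A for the exogenous regressors, e and u for the vectors of lagged and current
    errors, and q = A (A'A)^-1 alpha. Since X = A + e alpha' is a rank-one perturbation of A, its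
    annihilator is an explicit low-rank modification of that of A, and y'My becomes a rational
    function of u'Mu, e'Me, e'Mu, q'u and q'e, where M now denotes the annihilator of A.
    Given A, these are quadratic and linear forms in i.i.d. errors with matrices
    satisfying |M|^2 = tr M = T - K and |q|^2 = O_p(1/T), so Chebyshev's inequality
    replaces the first three, up to o_p(T), by sigma^2 (T - K), sigma^2 (T - K) and
    sigma^2 sum_t M_{t,t-1}, and the last two, up to o_p(1), by 0. The Sherman-Morrison formula for
    alpha' Sbar^-1 alpha identifies the resulting expression with the claimed one. *)
Require Import Defs.
From HB Require Import structures.
From mathcomp Require Import all_boot all_order all_algebra.
From mathcomp Require Import all_classical all_reals all_analysis.
From mathcomp Require Import measurable_realfun ring lra.
Import Order.TTheory GRing.Theory Num.Theory.
Set Implicit Arguments.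
Unset Strict Implicit.
Unset Printing Implicit Defensive.
Local Open Scope classical_set_scope.
Local Open Scope ring_scope.


(** * Projections and rank-one perturbations *)

Section Annihilator.
Context {R : realFieldType}.

(** No conditional expectation operator is formed. All that is used of the conditional law is one
    identity: the mean of a function of the regressors times a product of functions of the separate
    errors is unchanged when each factor is replaced by its integral under [kappa]. The moment
    bounds hold only almost surely, and T|q|^2 is bounded only in probability; Chebyshev's
    inequality is therefore applied to squares multiplied by the indicator of an event that is
    determined by the regressors and on which these bounds hold pointwise. The rest is
    deterministic: off finitely many bad events the error is at most a constant times [eta].
    Smallness of q'e keeps the denominator of the rational function away from 0, which also yields
    the full column rank of X, a fact that is not assumed. Since T - K exceeds cT, a variance of
    order T - K is negligible against (T - K)^2, and the subdiagonal sum divided by T - K stays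
    bounded. *)

Lemma sqnorm_mx00 n (x : 'cV[R]_n) : (x^T *m x) 0 0 = \sum_i x i 0 ^+ 2.
Proof. by rewrite mxE; apply: eq_bigr => i _; rewrite mxE expr2. Qed.

Lemma sqnorm_mx00_ge0 n (x : 'cV[R]_n) : 0 <= (x^T *m x) 0 0.
Proof. by rewrite sqnorm_mx00 sumr_ge0 // => i _; rewrite sqr_ge0. Qed.

Lemma sqnorm_mx00_eq0 n (x : 'cV[R]_n) : (x^T *m x) 0 0 = 0 -> x = 0.
Proof.
rewrite sqnorm_mx00 => /eqP; rewrite psumr_eq0 => [/allP h|i _]; last exact: sqr_ge0.
apply/matrixP => i j; rewrite ord1 mxE; apply/eqP; rewrite -sqrf_eq0.
by apply: h; rewrite mem_index_enum.
Qed.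

Lemma gram_unitmx n k (X : 'M[R]_(n, k)) : \rank X = k -> X^T *m X \in unitmx.
Proof.
move=> rX; rewrite -row_free_unit; apply/inj_row_free => v vXX.
have : v *m X^T = 0.
  apply: trmx_inj; rewrite trmx0; apply: sqnorm_mx00_eq0.
  by rewrite trmxK trmx_mul trmxK mulmxA -(mulmxA v) vXX mul0mx mxE.
have fX : row_free X^T by rewrite /row_free mxrank_tr rX.
by move/eqP; rewrite mulmx_free_eq0 // => /eqP.
Qed.

Lemma gram_inv_sym n k (X : 'M[R]_(n, k)) :
  (invmx (X^T *m X))^T = invmx (X^T *m X).
Proof. by rewrite trmx_inv trmx_mul trmxK. Qed.

Lemma annih_sym n k (X : 'M[R]_(n, k)) : (annih X)^T = annih X.
Proof.
by rewrite /annih linearB /= trmx1 !trmx_mul trmxK gram_inv_sym mulmxA.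
Qed.

Lemma annih_mul n k (X : 'M[R]_(n, k)) : \rank X = k -> annih X *m X = 0.
Proof.
move=> rX; rewrite /annih mulmxBl mul1mx -!mulmxA mulVmx ?gram_unitmx //.
by rewrite mulmx1 subrr.
Qed.

Lemma annih_idem n k (X : 'M[R]_(n, k)) : \rank X = k ->
  annih X *m annih X = annih X.
Proof.
move=> rX; rewrite {2}/annih mulmxBr mulmx1 !mulmxA annih_mul //.
by rewrite !mul0mx subr0.
Qed.

Lemma annih_trace n k (X : 'M[R]_(n, k)) : \rank X = k ->
  \tr (annih X) = n%:R - k%:R.
Proof.
move=> rX; rewrite /annih linearB /= mxtrace1 mxtrace_mulC mulmxA.
by rewrite mulmxV ?gram_unitmx // mxtrace1.
Qed.

(** A left inverse [W] forces full column rank. Then [annih X] kills [1 - N = X *m W], while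
    [annih X *m N = N] because symmetry turns [N *m X = 0] into [X^T *m N = 0]. A candidate
    annihilator is thus verified without inverting the Gram matrix of [X]. *)
Lemma annih_unique n k (X : 'M[R]_(n, k)) (N : 'M[R]_n) (W : 'M[R]_(k, n)) :
  W *m X = 1%:M -> N *m X = 0 -> N^T = N -> 1%:M - N = X *m W ->
  \rank X = k /\ annih X = N.
Proof.
move=> WX NX Nsym NW.
have rX : \rank X = k.
  apply/eqP; rewrite eqn_leq rank_leq_col /=.
  by have := mxrankM_maxr W X; rewrite WX mxrank1.
split=> //; have MN : annih X *m N = N.
  rewrite /annih mulmxBl mul1mx -!mulmxA.
  by rewrite -{2}Nsym -trmx_mul NX trmx0 !mulmx0 subr0.
rewrite -[LHS]mulmx1 -(subrK N 1%:M) mulmxDr MN NW mulmxA annih_mul //.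
by rewrite mul0mx add0r.
Qed.
End Annihilator.

Section RankOnePerturbation.
Context {R : realFieldType} {n k : nat}.
Variables (A : 'M[R]_(n, k)) (e : 'cV[R]_n) (al : 'cV[R]_k).
Hypothesis rA : \rank A = k.

Definition pert_dir : 'cV[R]_n := A *m invmx (A^T *m A) *m al.
Definition pert_res : 'cV[R]_n := annih A *m e.
Definition pert_norm : R := (al^T *m invmx (A^T *m A) *m al) 0 0.
Definition pert_proj : R := (pert_dir^T *m e) 0 0.
Definition pert_rss : R := (e^T *m annih A *m e) 0 0.
(* The ratio det (X'X) / det (A'A) for X = A + e *m al^T. *)
Definition pert_det : R :=
  (1 + pert_proj) ^+ 2 + pert_norm * pert_rss.

Local Notation q := pert_dir.
Local Notation tau := pert_norm.
Local Notation phi := pert_proj.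
Local Notation D := pert_det.
Local Notation f := pert_res.
Local Notation ff := pert_rss.
Local Notation Si := (invmx (A^T *m A)).
Local Notation a := (Si *m al).

Lemma pert_dir_sqnorm : q^T *m q = tau%:M.
Proof.
rewrite -[RHS]mx11_scalar /pert_dir !trmx_mul gram_inv_sym !mulmxA.
rewrite -(mulmxA _ A^T A) -(mulmxA al^T Si (_ *m _)) mulVmx ?gram_unitmx //.
by rewrite mulmx1.
Qed.

Lemma pert_norm_sum : tau = \sum_i q i 0 ^+ 2.
Proof. by rewrite -sqnorm_mx00 pert_dir_sqnorm mxE. Qed.

Lemma pert_norm_ge0 : 0 <= tau.
Proof. by rewrite pert_norm_sum sumr_ge0 // => i _; rewrite sqr_ge0. Qed.

Let qA : q^T *m A = al^T.
Proof.
rewrite /pert_dir !trmx_mul gram_inv_sym -!mulmxA mulVmx ?gram_unitmx //.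
by rewrite mulmx1.
Qed.

Let fA : f^T *m A = 0.
Proof. by rewrite /pert_res trmx_mul annih_sym -mulmxA annih_mul // mulmx0. Qed.

Let fe : f^T *m e = ff%:M.
Proof. by rewrite /pert_res trmx_mul annih_sym [LHS]mx11_scalar. Qed.

Let qe : q^T *m e = phi%:M.
Proof. by rewrite [LHS]mx11_scalar. Qed.

Let ala : al^T *m Si *m al = tau%:M.
Proof. by rewrite [LHS]mx11_scalar. Qed.

Let alSA : al^T *m Si *m A^T = q^T.
Proof. by rewrite /pert_dir !trmx_mul gram_inv_sym mulmxA. Qed.

(** Geometric origin, for [tau != 0]: the range of the perturbed matrix is the part of the range of
    [A] orthogonal to [q], plus the line of [v = (1 + phi) *: q + tau *: f], whose squared norm is
    [tau * D]. The annihilator therefore gains q q' / tau and loses v v' / (tau D). After expansion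
    the divisions by [tau] cancel, so the formula also covers [al = 0]. *)
Lemma annih_rank_one_perturbation : D != 0 ->
  \rank (A + e *m al^T)%R = k /\ annih (A + e *m al^T) = annih A + D^-1 *:
    (ff *: (q *m q^T) - tau *: (f *m f^T)
     - (1 + phi) *: (f *m q^T) - (1 + phi) *: (q *m f^T)).
Proof.
move=> D0; set N := (X in _ /\ _ = X).
(* W below is the pseudo-inverse (X'X)^-1 X' of X = A + e *m al^T. *)
pose w := D^-1 *: (tau *: f + (1 + phi) *: q).
pose W := Si *m A^T - D^-1 *: (ff *: (a *m q^T) - (1 + phi) *: (a *m f^T))
          - Si *m A^T *m e *m w^T.
have wA : w^T *m A = (D^-1 * (1 + phi)) *: al^T.
  rewrite /w linearZ linearD /= !linearZ /= -scalemxAl mulmxDl -!scalemxAl.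
  by rewrite fA qA scaler0 add0r scalerA.
have we : w^T *m e = (D^-1 * (tau * ff + (1 + phi) * phi))%:M.
  rewrite /w linearZ linearD /= !linearZ /= -scalemxAl mulmxDl -!scalemxAl.
  by rewrite fe qe !scale_scalar_mx -raddfD /= scale_scalar_mx.
apply: (@annih_unique _ _ _ _ _ W).
- have WA : W *m A = 1%:M - (D^-1 * ff) *: (a *m al^T)
      - (D^-1 * (1 + phi)) *: (Si *m A^T *m e *m al^T).
    rewrite /W !mulmxBl -!scalemxAl mulmxBl -!scalemxAl -!(mulmxA _ _ A) qA fA.
    rewrite wA mulVmx ?gram_unitmx // mulmx0 scaler0 subr0 scalerA.
    by rewrite -scalemxAr.
  have We : W *m e = (D^-1 * ff) *: a + (D^-1 * (1 + phi)) *: (Si *m A^T *m e).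
    rewrite /W !mulmxBl -!scalemxAl mulmxBl -!scalemxAl -!(mulmxA _ _ e) fe qe we.
    rewrite !mul_mx_scalar !mulmxA.
    move: (Si *m A^T *m e) (Si *m al) => u v.
    by move: D0; rewrite /D; move: ff phi tau => ? ? ? D0; apply/matrixP => i j; rewrite !mxE; field.
  rewrite mulmxDr mulmxA WA We !mulmxDl -!scalemxAl.
  move: (a *m al^T) (Si *m A^T *m e *m al^T) => u v.
  by move: ff phi tau D => ? ? ? ?; apply/matrixP => i j; rewrite !mxE; ring.
- have NA : N *m A = D^-1 *: (ff *: (q *m al^T) - (1 + phi) *: (f *m al^T)).
    rewrite /N mulmxDl annih_mul // add0r -scalemxAl !mulmxBl -!scalemxAl.
    by rewrite -!(mulmxA _ _ A) qA fA !mulmx0 !scaler0 !subr0.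
  have Ne : N *m e = D^-1 *: ((1 + phi) *: f - ff *: q).
    rewrite /N mulmxDl -/f -scalemxAl !mulmxBl -!scalemxAl -!(mulmxA _ _ e) qe.
    rewrite fe !mul_mx_scalar.
    move: f q => u v.
    by move: D0; rewrite /D; move: ff phi tau => ? ? ? D0; apply/matrixP => i j; rewrite !mxE; field.
  rewrite mulmxDr mulmxA NA Ne -scalemxAl mulmxBl -!scalemxAl.
  move: (f *m al^T) (q *m al^T) => u v.
  by move: ff phi tau D => ? ? ? ?; apply/matrixP => i j; rewrite !mxE; ring.
- apply/matrixP => i j; rewrite /N.
  have Mij : annih A j i = annih A i j by rewrite -{1}annih_sym mxE.
  move: ff phi tau D f q (annih A) Mij => ? ? ? ? ? ? M Mij.
  by rewrite !mxE !big_ord1 !mxE Mij; ring.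
- have alW : al^T *m W = q^T - D^-1 *: ((ff * tau) *: q^T - ((1 + phi) * tau) *: f^T)
      - phi *: w^T.
    rewrite /W !mulmxBr -!scalemxAr mulmxBr -!scalemxAr !mulmxA alSA.
    rewrite ala !mul_scalar_mx !scalerA.
    by rewrite [q^T *m e]qe mul_scalar_mx.
  rewrite mulmxDl -(mulmxA e) alW /W !mulmxBr -!scalemxAr !mulmxBr -!scalemxAr !mulmxA.
  have PA : A *m Si *m A^T = 1%:M - annih A by rewrite /annih opprB addrC subrK.
  rewrite PA -/q [X in _ - X *m _]mulmxBl mul1mx -/f [(e - _) *m _]mulmxBl.
  have wT : w^T = D^-1 *: (tau *: f^T + (1 + phi) *: q^T).
    by rewrite /w linearZ linearD /= !linearZ.
  rewrite wT -!scalemxAr !mulmxDr -!scalemxAr /N.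
  (* With these products as atoms, both sides are linear combinations of eight matrices, and the
     identity can be checked entrywise. *)
  rewrite -/f; move: (e *m q^T) (e *m f^T) (q *m q^T) (f *m f^T) (f *m q^T) (q *m f^T)
    (annih A) (1%:M : 'M[R]_n).
  move=> z1 z2 z3 z4 z5 z6 z7 z8.
  by move: D0; rewrite /D; move: ff phi tau => ? ? ? D0; apply/matrixP => i j; rewrite !mxE; field.
Qed.

Lemma resid_rank_one_perturbation (b : 'cV[R]_k) (u : 'cV[R]_n) : D != 0 ->
  let X := A + e *m al^T in
  ((X *m b + u)^T *m annih X *m (X *m b + u)) 0 0 =
  (u^T *m annih A *m u) 0 0 +
  (ff * (q^T *m u) 0 0 ^+ 2 - tau * (e^T *m annih A *m u) 0 0 ^+ 2
   - 2 * (1 + phi) * (e^T *m annih A *m u) 0 0 * (q^T *m u) 0 0) / D.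
Proof.
move=> D0 X; have [rX MX] := annih_rank_one_perturbation D0.
have -> : (X *m b + u)^T *m annih X *m (X *m b + u) = u^T *m annih X *m u.
  have XM : X^T *m annih X = 0 by rewrite -annih_sym -trmx_mul annih_mul // trmx0.
  rewrite mulmxDr [(X *m b + u)^T]linearD /= mulmxDl trmx_mul -(mulmxA _ X^T) XM.
  by rewrite mulmx0 add0r -(mulmxA u^T _ (X *m b)) (mulmxA (annih X)) annih_mul // mul0mx mulmx0 add0r.
have qu : q^T *m u = ((q^T *m u) 0 0)%:M by rewrite -mx11_scalar.
have uq : u^T *m q = ((q^T *m u) 0 0)%:M by rewrite -tr_scalar_mx -qu trmx_mul trmxK.
have fu : f^T *m u = ((e^T *m annih A *m u) 0 0)%:M.
  by rewrite -mx11_scalar /pert_res trmx_mul annih_sym.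
have uf : u^T *m f = ((e^T *m annih A *m u) 0 0)%:M.
  by rewrite -tr_scalar_mx -fu trmx_mul trmxK.
rewrite MX; move: (annih A) qu uq fu uf => M qu uq fu uf.
rewrite mulmxDr mulmxDl -scalemxAr -scalemxAl !(mulmxBr u^T) !(mulmxBl _ _ u).
rewrite -!scalemxAr -!scalemxAl !(mulmxA _ q) !(mulmxA _ f) uq uf.
rewrite !mul_scalar_mx -!scalemxAl qu fu.
rewrite !scale_scalar_mx.
move: (u^T *m M *m u) ((q^T *m u) 0 0) ((e^T *m M *m u) 0 0) ff phi tau D.
by move=> ? ? ? ? ? ? ?; rewrite !mxE /= !mulr1n; ring.
Qed.

Lemma pert_norm_shrunk (t : R) : 0 <= t ->
  (al^T *m invmx (A^T *m A + t *: (al *m al^T)) *m al) 0 0 = tau / (1 + t * tau).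
Proof.
move=> t0; have D0 : 1 + t * tau != 0.
  by rewrite gt_eqF // ltr_wpDr // mulr_ge0 // pert_norm_ge0.
set B := A^T *m A + _.
have Ba : B *m a = (1 + t * tau) *: al.
  rewrite /B mulmxDl mulmxA mulmxV ?gram_unitmx // mul1mx -scalemxAl.
  by rewrite -mulmxA (mulmxA al^T) ala mul_mx_scalar scalerA scalerDl scale1r.
(* The explicit right inverse serves to show that [B] is invertible; the value of [invmx B *m al] is
   then read off [Ba]. *)
have BV : B *m (Si - (t / (1 + t * tau)) *: (a *m (al^T *m Si))) = 1%:M.
  rewrite mulmxBr -scalemxAr (mulmxA B) Ba -scalemxAl scalerA divfK //.
  rewrite /B mulmxDl mulmxV ?gram_unitmx // -scalemxAl mulmxA.
  by rewrite addrK.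
have [uB _] := mulmx1_unit BV.
rewrite -mulmxA; have -> : invmx B *m al = (1 + t * tau)^-1 *: a.
  apply: (can_inj (mulKmx uB)).
  by rewrite mulKVmx // -scalemxAr Ba scalerA mulVf // scale1r.
by rewrite -scalemxAr mulmxA ala !mxE mulr1n mulrC.
Qed.
End RankOnePerturbation.


(** * Deterministic error bound for the rescaled ratio *)

Section ErrorBound.
Context {R : realFieldType}.

(** Term by term: [1] comes from [W], [4 * (C + 1)] from the term in p^2, [16 * g] from the cross
    term, and the multiple of [B] from the term in G^2. Here [4] bounds the inverse of the
    denominator, [g] bounds both [G] and [s * h], and the division by [c] stems from the division by
    [s]. *)
Definition err_const (c C B kap : R) : R :=
  let g := C * kap + 1 in
  (1 + 4 * (C + 1) + 16 * g + B * (8 * g + 4 * g ^+ 2 * (3 + B))) / c.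

Lemma ler_normM_bound (x y a b : R) : `|x| <= a -> `|y| <= b -> `|x * y| <= a * b.
Proof. by move=> xa yb; rewrite normrM ler_pM. Qed.

(** Here [s] is the error variance, [W], [x], [G] are u'Mu, e'Me, e'Mu divided by T - K, [h] is the
    subdiagonal sum divided by T - K, [b] is [tau] times T - K, and [p], [phi] are q'u, q'e. At
    [W = x = s], [G = s * h], [p = phi = 0] the two expressions coincide; the bound measures the
    departure from that point. *)
Lemma err_bound_scaled (c C B kap eta s b phi p W x G h : R) :
  0 < c -> c < s -> s < C -> 0 <= b <= B -> 0 <= kap ->
  0 <= eta <= 2^-1 -> 0 <= x -> `|h| <= kap ->
  `|W - s| <= eta -> `|x - s| <= eta -> `|G - s * h| <= eta ->
  `|p| <= eta -> `|phi| <= eta ->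
  `|(W + (x * p ^+ 2 - b * G ^+ 2 - 2 * (1 + phi) * G * p)
         / ((1 + phi) ^+ 2 + b * x)) / s
    - (1 - s * b * h ^+ 2 / (1 + b * s))| <= err_const c C B kap * eta.
Proof.
move=> c0 cs sC /andP[b0 bB] kap0 /andP[eta0 eta2] x0 hk WE xE GE pE phiE; set D := (1 + phi) ^+ 2 + b * x.
have s0 : 0 < s by lra.
have C0 : 0 < C by lra.
have B0 : 0 <= B by lra.
set g := C * kap + 1.
have g1 : 1 <= g.
  have : 0 <= C * kap by apply: mulr_ge0; lra.
  by rewrite /g; lra.
(* This is where [eta <= 2^-1] enters: [1 + phi] is at least one half, so the denominator stays away
   from 0 whatever [b * x] is. *)
have DE : (1 + phi) ^+ 2 >= 4^-1.
  by move: phiE; rewrite ler_norml => /andP[? ?]; nra.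
have bx0 : 0 <= b * x by apply: mulr_ge0.
have D4 : 4^-1 <= D by rewrite /D; lra.
have D0 : 0 < D by lra.
have iD : `|D^-1| <= 4.
  rewrite ger0_norm ?invr_ge0 ?(ltW D0) // -(ler_pM2l D0) mulfV ?gt_eqF //; lra.
pose H := s * h.
have HE : `|H| <= g.
  have : `|H| <= C * kap.
    by apply: ler_normM_bound => //; rewrite ger0_norm; lra.
  by rewrite /g; lra.
have Gg : `|G| <= g.
  have := ler_normD (G - s * h) (s * h); rewrite subrK => /le_trans; apply.
  have : `|s * h| <= C * kap by apply: ler_normM_bound => //; rewrite ger0_norm; lra.
  by rewrite /g; lra.
have xC : `|x| <= C + 1.
  by move: xE; rewrite ler_norml ger0_norm // => /andP[? ?]; lra.
have bn : `|b| <= B by rewrite ger0_norm.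
pose E0 := 1 + b * s.
have bs0 : 0 <= b * s by apply: mulr_ge0 => //; lra.
have E1 : 1 <= E0 by rewrite /E0; lra.
have iE : `|E0^-1| <= 1.
  by rewrite ger0_norm ?invr_ge0 ?invf_le1; lra.
have pphi : `|1 + phi| <= 2.
  by move: phiE; rewrite !ler_norml => /andP[? ?]; apply/andP; split; lra.
(* The difference is arranged so that every summand has a small factor; G^2/D - H^2/E0 is split into
   (G - H)(G + H)/D and H^2 (E0 - D)/(D E0). *)
have -> : (W + (x * p ^+ 2 - b * G ^+ 2 - 2 * (1 + phi) * G * p) / D) / s
    - (1 - s * b * h ^+ 2 / (1 + b * s)) =
  ((W - s) + x * p ^+ 2 * D^-1 - 2 * ((1 + phi) * G * p * D^-1)
   - b * ((G - H) * (G + H) * D^-1 + H ^+ 2 * (E0 - D) * (D^-1 * E0^-1))) / s.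
  have D1 : D != 0 by rewrite gt_eqF.
  have s1 : s != 0 by rewrite gt_eqF.
  have E2 : E0 != 0 by rewrite gt_eqF //; lra.
  move: D D1 E2 {D4 D0 iD DE E1 iE} => D' D1; rewrite /E0 /H => E2.
  by field; rewrite s1 D1 E2.
have t1 : `|x * p ^+ 2 * D^-1| <= (C + 1) * (eta * 1) * 4.
  apply: ler_normM_bound => //; apply: ler_normM_bound => //.
  by rewrite expr2; apply: ler_normM_bound => //; lra.
have t2 : `|(1 + phi) * G * p * D^-1| <= 2 * g * eta * 4.
  by do 3 apply: ler_normM_bound => //.
have t3 : `|(G - H) * (G + H) * D^-1| <= eta * (g + g) * 4.
  apply: ler_normM_bound => //; apply: ler_normM_bound => //.
  by apply: le_trans (ler_normD _ _) _; lra.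
have t4 : `|H ^+ 2 * (E0 - D) * (D^-1 * E0^-1)| <= g ^+ 2 * ((3 + B) * eta) * (4 * 1).
  apply: ler_normM_bound; last exact: ler_normM_bound.
  apply: ler_normM_bound.
    by rewrite normrX ler_sqr ?nnegrE //; lra.
  have -> : E0 - D = - (phi * (2 + phi) + b * (x - s)) by rewrite /E0 /D; ring.
  rewrite normrN; apply: le_trans (ler_normD _ _) _.
  have : `|phi * (2 + phi)| <= eta * 3.
    apply: ler_normM_bound => //.
    by move: phiE; rewrite !ler_norml => /andP[? ?]; apply/andP; split; lra.
  by have := ler_normM_bound bn xE; lra.
have t5 : `|b * ((G - H) * (G + H) * D^-1 + H ^+ 2 * (E0 - D) * (D^-1 * E0^-1))|
   <= B * (eta * (g + g) * 4 + g ^+ 2 * ((3 + B) * eta) * (4 * 1)).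
  apply: ler_normM_bound => //.
  by apply: le_trans (ler_normD _ _) _; apply: lerD.
have -> : err_const c C B kap * eta =
  (eta + (C + 1) * (eta * 1) * 4 + 2 * (2 * g * eta * 4)
   + B * (eta * (g + g) * 4 + g ^+ 2 * ((3 + B) * eta) * (4 * 1))) * c^-1.
  by rewrite /err_const -/g; ring.
apply: ler_normM_bound; last first.
  by rewrite ger0_norm ?invr_ge0 ?lef_pV2 ?posrE //; lra.
have t2' : `|2 * ((1 + phi) * G * p * D^-1)| <= 2 * (2 * g * eta * 4).
  by apply: ler_normM_bound => //; rewrite ger0_norm //; lra.
apply: le_trans (ler_normB _ _) _; apply: lerD t5.
apply: le_trans (ler_normB _ _) _; apply: lerD t2'.
by apply: le_trans (ler_normD _ _) _; apply: lerD t1.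
Qed.
End ErrorBound.


(** * Conditional product moments *)

Section IntegralSwap.
Local Open Scope ereal_scope.
Import HBNNSimple.

(** Multiplication by [+oo] is not continuous at 0. Monotonicity excludes the bad case: either the
    limit is 0 and all terms are 0, or some term is positive and the products are [+oo] from there
    on. *)
Lemma cvg_mule_nondecreasing (R : realType) (x l : \bar R) (u : (\bar R)^nat) :
  0 <= x -> (forall n, 0 <= u n) -> nondecreasing_seq u ->
  u @ \oo --> l -> x * u n @[n --> \oo] --> x * l.
Proof.
case: x => [x _ _ _|_ u0 undec ul|//]; first exact: cvgeZl.
have ule n : u n <= l.
  rewrite -(cvg_lim _ ul) //; apply: lime_ge; first exact: cvgP ul.
  by near=> k; apply: undec; near: k; exists n.
have l0 : 0 <= l := le_trans (u0 0%N) (ule 0%N).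
have [l_eq0|l_neq0] := eqVneq l 0.
  have uE n : u n = 0 by apply/eqP; rewrite eq_le u0 -l_eq0 ule.
  by under eq_fun do rewrite uE; rewrite l_eq0 !mule0; exact: cvg_cst.
have [n un] : exists n, 0 < u n.
  apply: contrapT => /forallNP h; move/eqP: l_neq0; apply.
  rewrite -(cvg_lim _ ul) //; apply: lim_near_cst => //.
  near=> n; apply/eqP; rewrite eq_le u0 andbT leNgt; apply/negP; exact: h.
rewrite gt0_mulye ?lt0e ?l_neq0 //; apply: cvg_near_cst.
near=> k; rewrite gt0_mulye //; apply: lt_le_trans un _; apply: undec.
by near: k; exists n.
Unshelve. all: by end_near. Qed.

Context {d d' : measure_display} {T : measurableType d} {Y : measurableType d'}.
Context {R : realType} (mu : {measure set T -> \bar R}).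
Variables (H H' : T -> \bar R) (V : T -> Y) (k : T -> {measure set Y -> \bar R}).
Hypothesis H0 : forall w, 0 <= H w.
Hypothesis H'0 : forall w, 0 <= H' w.
Hypothesis mH : measurable_fun setT H.
Hypothesis mH' : measurable_fun setT H'.
Hypothesis mV : measurable_fun setT V.
Hypothesis mk : forall B, measurable B -> measurable_fun setT (fun w => k w B).
Hypothesis HB : forall B, measurable B ->
  \int[mu]_w (H w * (\1_B (V w))%:E) = \int[mu]_w (H' w * k w B).

Let swap_nnsfun (f : {nnsfun Y >-> R}) :
  \int[mu]_w (H w * (f (V w))%:E) = \int[mu]_w (H' w * \int[k w]_y (f y)%:E).
Proof.
have mf r : measurable (f @^-1` [set r]) by [].
have kfE w : \int[k w]_y (f y)%:E = \sum_(r \in range f) (r%:E * k w (f @^-1` [set r])).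
  under eq_integral do rewrite fimfunE -fsumEFin //.
  rewrite ge0_integral_fsum //; last 2 first.
    - by move=> r; exact/measurable_EFinP/measurableT_comp.
    - by move=> r z _; rewrite EFinM nnfun_muleindic_ge0.
  apply: eq_fsbigr => r _; rewrite (integralZl_indic _ (fun r => f @^-1` [set r])) //; last first.
    by move=> r0; rewrite preimage_nnfun0.
  by rewrite integral_indic // setIT.
(* Nonnegativity is required for every real [r]; a negative one is not a value of [f], so its fibre
   is empty. *)
have rk0 r w : 0 <= r%:E * k w (f @^-1` [set r]).
  have [r0|r0] := leP 0%R r; first by rewrite mule_ge0 ?lee_fin.
  by rewrite preimage_nnfun0 // measure0 mule0.
have -> : \int[mu]_w (H w * (f (V w))%:E) =
    \int[mu]_w \sum_(r \in range f) (H w * (r * \1_(f @^-1` [set r]) (V w))%:E).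
  apply: eq_integral => w _; rewrite fimfunE -fsumEFin // fsbig_finite //=.
  rewrite ge0_sume_distrr ?fsbig_finite // => r _.
  by rewrite EFinM nnfun_muleindic_ge0.
have -> : \int[mu]_w (H' w * \int[k w]_y (f y)%:E) =
    \int[mu]_w \sum_(r \in range f) (H' w * (r%:E * k w (f @^-1` [set r]))).
  by apply: eq_integral => w _; rewrite kfE fsbig_finite //= ge0_sume_distrr ?fsbig_finite.
rewrite !ge0_integral_fsum //; last 4 first.
- by move=> r; apply: emeasurable_funM => //; apply: measurable_funeM; exact: mk.
- by move=> r w _; rewrite mule_ge0.
- move=> r; apply: emeasurable_funM => //; apply/measurable_EFinP.
  by apply: measurable_funM => //; exact: measurableT_comp.
- by move=> r w _; rewrite mule_ge0 // EFinM nnfun_muleindic_ge0.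
apply: eq_fsbigr => r _; have [r0|r0] := leP 0%R r; last first.
  rewrite !integral0_eq // => w _; rewrite preimage_nnfun0 //.
    by rewrite measure0 !mule0.
  by rewrite indic0 mulr0 mule0.
under eq_integral do rewrite EFinM muleCA.
under [RHS]eq_integral do rewrite muleCA.
have mI : measurable_fun setT (fun w => H w * (\1_(f @^-1` [set r]) (V w))%:E).
  by apply: emeasurable_funM => //; apply/measurable_EFinP; exact: measurableT_comp.
have mK : measurable_fun setT (fun w => H' w * k w (f @^-1` [set r])).
  by apply: emeasurable_funM => //; exact: mk.
rewrite !ge0_integralZl ?lee_fin //.
- by rewrite HB.
- by move=> w _; rewrite mule_ge0.
- by move=> w _; rewrite mule_ge0.
Qed.

(** Simple functions and monotone convergence extend [HB] from indicators. It serves twice: with [V]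
    a single error and [k] the conditional law, and with [V = pi] and [k] a Dirac mass. *)
Lemma integral_swap (f : Y -> \bar R) : (forall y, 0 <= f y) ->
  measurable_fun setT f ->
  \int[mu]_w (H w * f (V w)) = \int[mu]_w (H' w * \int[k w]_y f y).
Proof.
move=> f0 mf; pose g := nnsfun_approx measurableT mf.
have g0 n y : 0 <= (g n y)%:E by rewrite lee_fin.
have ndg y : nondecreasing_seq (fun n => (g n y)%:E).
  by move=> a b ab; rewrite lee_fin; exact/lefP/nd_nnsfun_approx.
have cg y : (g n y)%:E @[n --> \oo] --> f y by exact: cvg_nnsfun_approx.
have mg n : measurable_fun setT (fun y => (g n y)%:E) by exact/measurable_EFinP.
have mgV n : measurable_fun setT (fun w => (g n (V w))%:E).
  by apply/measurable_EFinP; exact: measurableT_comp.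
have mK n : measurable_fun setT (fun w => \int[k w]_y (g n y)%:E).
  by apply: measurable_fun_integral_kernel => // U mU; exact: mk.
have K0 n w : 0 <= \int[k w]_y (g n y)%:E by apply: integral_ge0.
have ndK w : nondecreasing_seq (fun n => \int[k w]_y (g n y)%:E).
  by move=> a b ab; apply: ge0_le_integral => // y _; exact: ndg.
have cK w : \int[k w]_y (g n y)%:E @[n --> \oo] --> \int[k w]_y f y.
  have -> : \int[k w]_y f y = \int[k w]_y (limn (fun n => (g n y)%:E)).
    by apply: eq_integral => y _; rewrite (cvg_lim _ (cg y)).
  by apply: cvg_monotone_convergence => // y _; exact: ndg.
transitivity (limn (fun n => \int[mu]_w (H w * (g n (V w))%:E))).
  rewrite -monotone_convergence //.
  - apply: eq_integral => w _; apply/esym/cvg_lim => //.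
    exact: cvg_mule_nondecreasing.
  - by move=> n; exact: emeasurable_funM.
  - by move=> n w _; rewrite mule_ge0.
  - by move=> w _ a b ab; apply: lee_wpmul2l => //; exact: ndg.
under eq_fun do rewrite swap_nnsfun.
rewrite -monotone_convergence //.
- apply: eq_integral => w _; apply/cvg_lim => //.
  exact: cvg_mule_nondecreasing.
- by move=> n; exact: emeasurable_funM.
- by move=> n w _; rewrite mule_ge0.
- by move=> w _ a b ab; apply: lee_wpmul2l => //; exact: ndK.
Qed.
End IntegralSwap.


Lemma emeasurable_prod d (T : measurableType d) (R : realType) (I : Type)
    (s : seq I) (p : pred I) (h : I -> T -> \bar R) :
  (forall i, measurable_fun setT (h i)) ->
  measurable_fun setT (fun w => \prod_(i <- s | p i) h i w)%E.
Proof.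
move=> mh; elim: s => [|i s IH].
  by under eq_fun do rewrite big_nil; exact: measurable_cst.
under eq_fun do rewrite big_cons.
by case: (p i) => //; exact: emeasurable_funM.
Qed.

(* The conditioning sigma-algebra is represented by the measurable space W, on which the
   regular conditional law kap lives; pi is the identity when W is Om with that sigma-algebra. *)
Section ConditionalProduct.
Context {d d' : measure_display} {Om : measurableType d} {W : measurableType d'}.
Context {R : realType} (P : probability Om R).
Variables (pi : Om -> W) (kap : W -> probability R R) (n : nat) (eps : 'I_n -> Om -> R).
Hypothesis mpi : measurable_fun setT pi.
Hypothesis mkap : forall B, measurable B -> measurable_fun setT (fun w => kap w B).
Hypothesis meps : forall t, measurable_fun setT (eps t).
Hypothesis law : forall (A : set W) (B : 'I_n -> set R),
  measurable A -> (forall t, measurable (B t)) ->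
  P ((pi @^-1` A) `&` [set w | forall t, B t (eps t w)])
  = (\int[P]_(w in pi @^-1` A) \prod_(t < n) kap (pi w) (B t))%E.
Local Open Scope ereal_scope.

Let mkpi B : measurable B -> measurable_fun setT (fun w => kap (pi w) B).
Proof. by move=> mB; apply: (measurableT_comp (mkap mB)). Qed.

Let ind (T : Type) (B : set T) (x : T) : \bar R := (\1_B x)%:E.

Let cond_prod_ind (A : set W) (B : 'I_n -> set R) :
  measurable A -> (forall t, measurable (B t)) ->
  \int[P]_w (ind A (pi w) * \prod_t ind (B t) (eps t w)) =
  \int[P]_w (ind A (pi w) * \prod_t \int[kap (pi w)]_x ind (B t) x).
Proof.
move=> mA mB.
have mA' : measurable (pi @^-1` A) by rewrite -[X in measurable X]setTI; exact: mpi.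
transitivity (P ((pi @^-1` A) `&` [set w | forall t, B t (eps t w)])).
  rewrite -[X in P X]setIT -integral_indic //; last first.
    apply: measurableI => //.
    rewrite (_ : mkset _ = \bigcap_(t in [set: 'I_n]) (eps t @^-1` B t)); last first.
      by apply/seteqP; split => [w h t _|w h t]; exact: h.
    apply: fin_bigcap_measurable => // t _.
    by rewrite -[X in measurable X]setTI; exact: meps.
  apply: eq_integral => w _; rewrite /ind prodEFin -EFinM; congr EFin.
  rewrite !indicE in_setI; have [wA|wA] := boolP (pi w \in A); last first.
    by rewrite mul0r; case: (boolP (w \in pi @^-1` A)) wA => // /[!inE] h /negP; case; rewrite inE.
  have -> : (w \in pi @^-1` A) by move: wA; rewrite !inE.
  rewrite mul1r /=; case: (boolP (w \in _)) => [|h].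
    rewrite inE => h; rewrite big1 // => t _; rewrite indicE mem_set //; exact: h.
  have [t wt] : exists t, ~ B t (eps t w).
    by apply: contrapT => /forallNP k; move/negP: h; apply; rewrite inE => t; exact: contrapT.
  by rewrite (bigD1 t) //= indicE memNset // mul0r.
rewrite law // [LHS]integral_mkcond; apply: eq_integral => w _.
rewrite /patch /ind indicE; case: (boolP (w \in _)) => [wA|wA].
  have -> : pi w \in A by move: wA; rewrite !inE.
  rewrite mul1e; apply: eq_bigr => t _.
  by rewrite integral_indic // setIT.
have -> : (pi w \in A) = false by apply/negbTE; apply: contra wA; rewrite !inE.
by rewrite mul0e.
Qed.

Let mind d1 (T : measurableType d1) (B : set T) : measurable B ->
  measurable_fun setT (ind B : T -> \bar R).
Proof. by move=> mB; apply/measurable_EFinP; exact: measurable_indic. Qed.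

Let ind_ge0 (T : Type) (B : set T) x : 0 <= ind B x.
Proof. by rewrite lee_fin. Qed.

Let cond_prod_indw (A : set W) (h : 'I_n -> R -> \bar R) :
  measurable A -> (forall t x, 0 <= h t x) -> (forall t, measurable_fun setT (h t)) ->
  \int[P]_w (ind A (pi w) * \prod_t h t (eps t w)) =
  \int[P]_w (ind A (pi w) * \prod_t \int[kap (pi w)]_x h t x).
Proof.
move=> mA.
(* Indicators are replaced by arbitrary nonnegative functions one coordinate at a time. *)
suff H k : (k <= n)%N -> forall h : 'I_n -> R -> \bar R,
    (forall t x, 0 <= h t x) -> (forall t, measurable_fun setT (h t)) ->
    (forall t : 'I_n, (k <= t)%N -> exists2 B, measurable B & h t = ind B) ->
    \int[P]_w (ind A (pi w) * \prod_t h t (eps t w)) =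
    \int[P]_w (ind A (pi w) * \prod_t \int[kap (pi w)]_x h t x).
  by move=> h0 mh; apply: (H n) => // t; rewrite leqNgt ltn_ord.
elim: k => [_ {}h h0 mh /(_ _ isT) hB|k IH kn {}h h0 mh hB].
  have /choice[B BE] : forall t, exists B, measurable B /\ h t = ind B.
    by move=> t; have [B mB ->] := hB t; exists B.
  have -> : h = fun t => ind (B t) by apply/funext => t; case: (BE t).
  by apply: cond_prod_ind => // t; case: (BE t).
pose t0 := Ordinal kn.
have mhe t : measurable_fun setT (fun w => h t (eps t w)) by exact: measurableT_comp.
have mhk t : measurable_fun setT (fun w => \int[kap (pi w)]_x h t x).
  by apply: measurable_fun_integral_kernel => // U mU; exact: mkpi.
have hk0 t w : 0 <= \int[kap (pi w)]_x h t x by apply: integral_ge0.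
have mA1 : measurable_fun setT (fun w => ind A (pi w)) by apply: measurableT_comp => //; exact: mind.
under eq_integral do rewrite (bigD1 t0) //= muleCA muleC.
under [RHS]eq_integral do rewrite (bigD1 t0) //= muleCA muleC.
apply: (integral_swap (k := fun w => kap (pi w))) => //.
- by move=> w; rewrite mule_ge0 // prode_ge0.
- by move=> w; rewrite mule_ge0 // prode_ge0.
- by apply: emeasurable_funM => //; exact: emeasurable_prod.
- by apply: emeasurable_funM => //; exact: emeasurable_prod.
move=> B mB.
(* Testing coordinate [t0] against indicators is enough, and with an indicator there the induction
   hypothesis applies. *)
pose h' t := if t == t0 then ind B else h t.
transitivity (\int[P]_w (ind A (pi w) * \prod_t h' t (eps t w))).
  apply: eq_integral => w _; rewrite [in RHS](bigD1 t0) //= {1}/h' eqxx muleCA muleC.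
  congr (_ * _); congr (_ * _).
  by apply: eq_bigr => t /negbTE tt0; rewrite /h' tt0.
rewrite IH //.
- apply: eq_integral => w _; rewrite (bigD1 t0) //= {1}/h' eqxx muleCA muleC.
  rewrite integral_indic // setIT; congr (_ * _); congr (_ * _).
  by apply: eq_bigr => t /negbTE tt0; rewrite /h' tt0.
- exact: ltnW.
- by move=> t x; rewrite /h'; case: ifP.
- by move=> t; rewrite /h'; case: ifP => // _; exact: mind.
- move=> t kt; rewrite /h'; case: eqVneq => [_|tt0]; first by exists B.
  by apply: hB; rewrite ltn_neqAle kt andbT; apply: contra tt0 => /eqP kt'; apply/eqP/val_inj.
Qed.

Lemma cond_prod_ge0 (g : W -> \bar R) (h : 'I_n -> R -> \bar R) :
  (forall w, 0 <= g w) -> measurable_fun setT g ->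
  (forall t x, 0 <= h t x) -> (forall t, measurable_fun setT (h t)) ->
  \int[P]_w (g (pi w) * \prod_t h t (eps t w)) =
  \int[P]_w (g (pi w) * \prod_t \int[kap (pi w)]_x h t x).
Proof.
move=> g0 mg h0 mh.
have mhe t : measurable_fun setT (fun w => h t (eps t w)) by exact: measurableT_comp.
have mhk t : measurable_fun setT (fun w => \int[kap (pi w)]_x h t x).
  by apply: measurable_fun_integral_kernel => // U mU; exact: mkpi.
have hk0 t w : 0 <= \int[kap (pi w)]_x h t x by apply: integral_ge0.
under eq_integral do rewrite muleC.
(* With the Dirac kernel at [pi w] the same exchange turns indicator weights into an arbitrary
   nonnegative weight [g]. *)
rewrite (integral_swap (H' := fun w => \prod_t \int[kap (pi w)]_x h t x)
   (k := fun w => dirac (pi w))) //.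
- by apply: eq_integral => w _; rewrite integral_dirac // diracT mul1e muleC.
- by move=> w; rewrite prode_ge0.
- by move=> w; rewrite prode_ge0.
- exact: emeasurable_prod.
- exact: emeasurable_prod.
- by move=> B mB; apply: (measurableT_comp (f := fun x => dirac x B)) => //; exact: mind.
- move=> B mB; under eq_integral do rewrite muleC.
  by under [RHS]eq_integral do rewrite muleC; exact: cond_prod_indw.
Qed.

Local Open Scope ring_scope.

(** Off an almost sure event the integral may be infinite, and [fine] then returns 0; this does no
    harm because [cmom] is multiplied below by weights vanishing there. *)
Definition cmom (f : R -> R) (w : W) : R := fine (\int[kap w]_x (f x)%:E)%E.

Lemma measurable_cintegral (f : R -> \bar R) : measurable_fun setT f ->
  measurable_fun setT (fun w => \int[kap w]_x f x)%E.
Proof.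
move=> mf; under eq_fun do rewrite integralE.
apply: emeasurable_funB; apply: measurable_fun_integral_kernel => //.
  exact: measurable_funepos.
exact: measurable_funeneg.
Qed.

Lemma measurable_cmom (f : R -> R) : measurable_fun setT f -> measurable_fun setT (cmom f).
Proof.
move=> mf; apply: measurableT_comp => //.
by apply: measurable_cintegral; exact/measurable_EFinP.
Qed.

(* The bound on the conditional moments is only required where the weight g does not vanish:
   it is available only almost surely. *)
Definition cond_bounded (L : R) (g : W -> R) (h : 'I_n -> R -> R) : Prop :=
  [/\ measurable_fun setT g, (forall t, measurable_fun setT (h t)),
      (forall w, `|g w| <= L) &
      (forall w t, g w != 0 -> (\int[kap w]_x (`|h t x|)%:E <= L%:E)%E)].

Let bounded_integrable (f : Om -> R) (L : R) : measurable_fun setT f ->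
  (forall w, `|f w| <= L) -> P.-integrable setT (EFin \o f).
Proof.
move=> mf fL; apply: (@le_integrable _ _ _ P setT measurableT _ (EFin \o cst L)).
- exact/measurable_EFinP.
- by move=> w _ /=; rewrite lee_fin; apply: le_trans (fL w) (ler_norm _).
- exact: finite_measure_integrable_cst.
Qed.

Let integral_norm_fin (g : W -> R) h L w t : cond_bounded L g h -> g w != 0 ->
  (\int[kap w]_x (`|h t x|)%:E)%E \is a fin_num.
Proof.
move=> [_ _ _ hL] gw; rewrite ge0_fin_numE; last first.
  by apply: integral_ge0 => x _; rewrite lee_fin.
by apply: le_lt_trans (hL w t gw) _; rewrite ltry.
Qed.

Let cmom_le (g : W -> R) h L w t : cond_bounded L g h -> g w != 0 -> `|cmom (h t) w| <= L.
Proof.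
move=> hb gw; have [_ mh _ hL] := hb.
have h1 : (`|\int[kap w]_x (h t x)%:E| <= \int[kap w]_x (`|h t x|)%:E)%E.
  by apply: (le_abse_integral _ measurableT); exact/measurable_EFinP.
have h2 : (`|\int[kap w]_x (h t x)%:E| <= L%:E)%E by apply: le_trans h1 (hL _ _ gw).
have fn : (\int[kap w]_x (h t x)%:E)%E \is a fin_num.
  by rewrite -abse_fin_num ge0_fin_numE // (le_lt_trans h2) // ltry.
by move: h2; rewrite -(fineK fn) /= lee_fin.
Qed.

(** The nonnegative identity applied to absolute values bounds the mean by [L * L ^+ n].
    Integrability is what allows signed factors to be split into differences. *)
Lemma integrable_prod g h L : cond_bounded L g h ->
  P.-integrable setT (EFin \o (fun w => g (pi w) * \prod_t h t (eps t w))).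
Proof.
move=> hb; have [mg mh gL hL] := hb.
have L0 : 0 <= L by apply: le_trans (normr_ge0 _) (gL point).
apply/integrableP; split.
  apply/measurable_EFinP; apply: measurable_funM; first exact: measurableT_comp.
  by apply: measurable_prod => t _; exact: measurableT_comp.
under eq_integral do
  rewrite /= normrM normr_prod EFinM -prodEFin.
rewrite (cond_prod_ge0 (g := fun w => (`|g w|)%:E) (h := fun t x => (`|h t x|)%:E)) //; last 2 first.
- by apply/measurable_EFinP; exact: measurableT_comp.
- by move=> t; apply/measurable_EFinP; exact: measurableT_comp.
apply: (@le_lt_trans _ _ (\int[P]_w (L * L ^+ n)%:E)%E); last first.
  rewrite integral_cst // (_ : _ [set: Om] = 1%E) ?mule1 ?ltry //; exact: probability_setT.
have mk t : measurable_fun setT (fun w => \int[kap (pi w)]_x (`|h t x|)%:E)%E.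
  apply: (measurableT_comp (measurable_cintegral _)) => //.
  by apply/measurable_EFinP; exact: measurableT_comp.
apply: ge0_le_integral => //.
- move=> w _; rewrite mule_ge0 ?lee_fin // prode_ge0 // => t _.
  by apply: integral_ge0 => x _; rewrite lee_fin.
- apply: emeasurable_funM; last exact: emeasurable_prod.
  by apply/measurable_EFinP; apply: measurableT_comp => //; exact: measurableT_comp.
move=> w _; have [gw|gw] := eqVneq (g (pi w)) 0.
  by rewrite gw normr0 mul0e lee_fin mulr_ge0 // exprn_ge0.
under eq_bigr do rewrite -(fineK (integral_norm_fin _ hb gw)).
rewrite prodEFin -EFinM lee_fin ler_pM //.
  by apply: prodr_ge0 => t _; rewrite fine_ge0 // integral_ge0 // => x _; rewrite lee_fin.
rewrite -[X in _ ^+ X](card_ord n) -prodr_const; apply: ler_prod => t _.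
apply/andP; split; first by rewrite fine_ge0 // integral_ge0 // => x _; rewrite lee_fin.
by rewrite -lee_fin fineK ?hL // (integral_norm_fin _ hb).
Qed.

Lemma integrable_cmom_prod g h L : cond_bounded L g h ->
  P.-integrable setT (EFin \o (fun w => g (pi w) * \prod_t cmom (h t) (pi w))).
Proof.
move=> hb; have [mg mh gL hL] := hb.
have L0 : 0 <= L by apply: le_trans (normr_ge0 _) (gL point).
apply: (@bounded_integrable _ (L * L ^+ n)).
  apply: measurable_funM; first exact: measurableT_comp.
  by apply: measurable_prod => t _; apply: (measurableT_comp (measurable_cmom _)).
move=> w; have [gw|gw] := eqVneq (g (pi w)) 0.
  by rewrite gw mul0r normr0 mulr_ge0 // exprn_ge0.
rewrite normrM ler_pM // normr_prod -[X in _ ^+ X](card_ord n) -prodr_const.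
by apply: ler_prod => t _; rewrite normr_ge0 (cmom_le _ hb gw).
Qed.

Let cond_prod_nonneg g h L : cond_bounded L g h -> (forall w, 0 <= g w) ->
  (forall t x, 0 <= h t x) ->
  (\int[P]_w (g (pi w) * \prod_t h t (eps t w))%:E =
  \int[P]_w (g (pi w) * \prod_t cmom (h t) (pi w))%:E)%E.
Proof.
move=> hb g0 h0; have [mg mh gL hL] := hb.
under eq_integral do rewrite EFinM -prodEFin.
rewrite (cond_prod_ge0 (g := EFin \o g) (h := fun t => EFin \o h t)) //; last 2 first.
- exact/measurable_EFinP.
- by move=> t; exact/measurable_EFinP.
apply: eq_integral => w _; have [gw|gw] := eqVneq (g (pi w)) 0.
  by rewrite /= gw mul0e mul0r.
rewrite EFinM -prodEFin; congr (_ * _)%E; apply: eq_bigr => t _.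
have := integral_norm_fin t hb gw; rewrite /cmom.
by under eq_integral do rewrite ger0_norm //; move=> /fineK ->.
Qed.

Let cond_bounded_le L g h (t0 : 'I_n) (f : R -> R) : cond_bounded L g h ->
  measurable_fun setT f -> (forall x, `|f x| <= `|h t0 x|) ->
  cond_bounded L g (fun t => if t == t0 then f else h t).
Proof.
move=> [mg mh gL hL] mf fh; split => //; first by move=> t; case: ifP.
move=> w t gw; case: eqVneq => [_|_]; last exact: hL.
apply: le_trans (hL w t0 gw); apply: ge0_le_integral => //.
- by apply/measurable_EFinP; exact: measurableT_comp.
- by apply/measurable_EFinP; exact: measurableT_comp.
- by move=> x _; rewrite lee_fin.
Qed.

(** [absD] and [absB] are the positive and the negative part of [f], both nonnegative and dominated
    by its absolute value. *)
Let absD (f : R -> R) x := (`|f x| + f x) / 2.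
Let absB (f : R -> R) x := (`|f x| - f x) / 2.

Let measurable_absD f : measurable_fun setT f -> measurable_fun setT (absD f).
Proof.
move=> mf; apply: measurable_funM => //; apply: measurable_funD => //.
exact: measurableT_comp.
Qed.

Let measurable_absB f : measurable_fun setT f -> measurable_fun setT (absB f).
Proof.
move=> mf; apply: measurable_funM => //; apply: measurable_funB => //.
exact: measurableT_comp.
Qed.

Let absD_itv (a : R) : 0 <= (`|a| + a) / 2 <= `|a|.
Proof. by have := ler_norm (- a); have := ler_norm a; rewrite normrN; lra. Qed.

Let absB_itv (a : R) : 0 <= (`|a| - a) / 2 <= `|a|.
Proof. by have := ler_norm (- a); have := ler_norm a; rewrite normrN; lra. Qed.

Let absD_le f x : `|absD f x| <= `|f x|.
Proof. by have /andP[? ?] := absD_itv (f x); rewrite ger0_norm. Qed.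

Let absB_le f x : `|absB f x| <= `|f x|.
Proof. by have /andP[? ?] := absB_itv (f x); rewrite ger0_norm. Qed.

Let absDB f x : f x = absD f x - absB f x.
Proof. by rewrite /absD /absB; lra. Qed.

Let cmom_absDB L g h t w : cond_bounded L g h -> g w != 0 ->
  cmom (h t) w = cmom (absD (h t)) w - cmom (absB (h t)) w.
Proof.
move=> hb gw; have [mg mh gL hL] := hb.
have ih : (kap w).-integrable setT (EFin \o h t).
  apply/integrableP; split; first exact/measurable_EFinP.
  by apply: le_lt_trans (hL w t gw) _; rewrite ltry.
have i1 : (kap w).-integrable setT (EFin \o absD (h t)).
  apply: le_integrable ih => //; first by apply/measurable_EFinP; exact: measurable_absD.
  by move=> x _ /=; rewrite lee_fin absD_le.
have i2 : (kap w).-integrable setT (EFin \o absB (h t)).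
  apply: le_integrable ih => //; first by apply/measurable_EFinP; exact: measurable_absB.
  by move=> x _ /=; rewrite lee_fin absB_le.
rewrite /cmom -fineB ?integrable_fin_num // -integralB_EFin //.
by congr fine; apply: eq_integral => x _; rewrite -EFinB -absDB.
Qed.

Let prod_subr_coord (F F1 F2 : 'I_n -> R) (t0 : 'I_n) : F t0 = F1 t0 - F2 t0 ->
  (forall t, t != t0 -> F t = F1 t) -> (forall t, t != t0 -> F t = F2 t) ->
  \prod_t F t = \prod_t F1 t - \prod_t F2 t.
Proof.
move=> E0 E1 E2; rewrite (bigD1 t0) //= [in X in X - _](bigD1 t0) //=.
rewrite [in X in _ - X](bigD1 t0) //= E0 mulrBl.
by congr (_ * _ - _ * _); apply: eq_bigr => t tt0; rewrite -?E1 -?E2.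
Qed.

Let cond_prod_posw L g h : cond_bounded L g h -> (forall w, 0 <= g w) ->
  (\int[P]_w (g (pi w) * \prod_t h t (eps t w))%:E =
  \int[P]_w (g (pi w) * \prod_t cmom (h t) (pi w))%:E)%E.
Proof.
move=> hb g0.
(* Only the first [k] factors may change sign. Splitting one of them into its two parts leaves two
   products with one signed factor fewer, instead of expanding all factors at once. *)
suff H k : (k <= n)%N -> forall h : 'I_n -> R -> R, cond_bounded L g h ->
    (forall t : 'I_n, (k <= t)%N -> forall x, 0 <= h t x) ->
    (\int[P]_w (g (pi w) * \prod_t h t (eps t w))%:E =
     \int[P]_w (g (pi w) * \prod_t cmom (h t) (pi w))%:E)%E.
  by apply: (H n) => // t; rewrite leqNgt ltn_ord.
elim: k => [_ {hb}h hb /(_ _ isT)|k IH kn {hb}h hb h0].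
  by move=> h0; exact: cond_prod_nonneg hb _ _.
pose t0 := Ordinal kn; have [mg mh gL hL] := hb.
pose h1 t := if t == t0 then absD (h t0) else h t.
pose h2 t := if t == t0 then absB (h t0) else h t.
have hb1 : cond_bounded L g h1 by apply: cond_bounded_le => //; exact: measurable_absD.
have hb2 : cond_bounded L g h2 by apply: cond_bounded_le => //; exact: measurable_absB.
have kt (t : 'I_n) : (k <= t)%N -> t != t0 -> (k < t)%N.
  move=> kt tt0; rewrite ltn_neqAle kt andbT; apply: contra tt0 => /eqP kt'.
  exact/eqP/val_inj.
have h10 (t : 'I_n) : (k <= t)%N -> forall x, 0 <= h1 t x.
  move=> kle x; rewrite /h1; case: eqVneq => [_|tt0]; last exact: h0 (kt _ _ _) _.
  by have /andP[] := absD_itv (h t0 x).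
have h20 (t : 'I_n) : (k <= t)%N -> forall x, 0 <= h2 t x.
  move=> kle x; rewrite /h2; case: eqVneq => [_|tt0]; last exact: h0 (kt _ _ _) _.
  by have /andP[] := absB_itv (h t0 x).
transitivity (\int[P]_w ((g (pi w) * \prod_t h1 t (eps t w))%:E
                         - (g (pi w) * \prod_t h2 t (eps t w))%:E))%E.
  apply: eq_integral => w _; rewrite -EFinB -mulrBr; congr (_ * _)%:E.
  apply: (@prod_subr_coord _ _ _ t0); rewrite /h1 /h2 ?eqxx.
  - exact: absDB.
  - by move=> t /negbTE ->.
  - by move=> t /negbTE ->.
rewrite integralB_EFin //; [|exact: integrable_prod hb1|exact: integrable_prod hb2].
rewrite (IH (ltnW kn) _ hb1 h10) (IH (ltnW kn) _ hb2 h20).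
rewrite -integralB_EFin //; [|exact: integrable_cmom_prod hb1|exact: integrable_cmom_prod hb2].
apply: eq_integral => w _; rewrite -EFinB -mulrBr.
have [->|gw] := eqVneq (g (pi w)) 0; first by rewrite !mul0r.
congr (_ * _)%:E.
apply/esym/(@prod_subr_coord _ _ _ t0); rewrite /h1 /h2 ?eqxx.
- exact: cmom_absDB hb gw.
- by move=> t /negbTE ->.
- by move=> t /negbTE ->.
Qed.

Lemma cond_prod L g h : cond_bounded L g h ->
  (\int[P]_w (g (pi w) * \prod_t h t (eps t w))%:E =
  \int[P]_w (g (pi w) * \prod_t cmom (h t) (pi w))%:E)%E.
Proof.
move=> hb; have [mg mh gL hL] := hb.
(* The two parts of the weight vanish wherever [g] does, so they inherit the moment bounds. *)
pose g1 w := (`|g w| + g w) / 2; pose g2 w := (`|g w| - g w) / 2.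
have ng : measurable_fun setT (fun w => `|g w|) by exact: measurableT_comp.
have hb1 : cond_bounded L g1 h.
  split => //; first by apply: measurable_funM => //; exact: measurable_funD.
  - move=> w; apply: le_trans (gL w); rewrite /g1.
    by have /andP[? ?] := absD_itv (g w); rewrite ger0_norm.
  - by move=> w t gw; apply: hL; apply: contraNneq gw => gw; rewrite /g1 gw normr0 addr0 mul0r.
have hb2 : cond_bounded L g2 h.
  split => //; first by apply: measurable_funM => //; exact: measurable_funB.
  - move=> w; apply: le_trans (gL w); rewrite /g2.
    by have /andP[? ?] := absB_itv (g w); rewrite ger0_norm.
  - by move=> w t gw; apply: hL; apply: contraNneq gw => gw; rewrite /g2 gw normr0 subr0 mul0r.
have gE w : g w = g1 w - g2 w by rewrite /g1 /g2; lra.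
have g10 w : 0 <= g1 w by have /andP[] := absD_itv (g w).
have g20 w : 0 <= g2 w by have /andP[] := absB_itv (g w).
under eq_integral do rewrite gE mulrBl EFinB.
rewrite integralB_EFin //; [|exact: integrable_prod hb1|exact: integrable_prod hb2].
rewrite (cond_prod_posw hb1) // (cond_prod_posw hb2) //.
rewrite -integralB_EFin //; [|exact: integrable_cmom_prod hb1|exact: integrable_cmom_prod hb2].
by apply: eq_integral => w _; rewrite -EFinB -mulrBl -gE.
Qed.

End ConditionalProduct.


(** * Moments of products of i.i.d. errors *)

Ltac do_words mu1 :=
  repeat (rewrite ?eqxx /= ?orbT ?orbF /=; match goal with
    | H : (?a == ?b) = false |- context [?a == ?b] => rewrite H
    | H : (?a == ?b) = false |- context [?b == ?a] => rewrite (eq_sym b a) H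
    end);
  rewrite ?eqxx /= ?big_cons ?big_nil /=;
  repeat (rewrite ?eqxx /=; match goal with
    | H : (?a == ?b) = false |- context [?a == ?b] => rewrite H
    | H : (?a == ?b) = false |- context [?b == ?a] => rewrite (eq_sym b a) H
    end);
  rewrite ?eqxx /= ?addn0 ?add0n ?addn1 ?mu1; ring.

Section WordMoments.
Context {R : realType} {n : nat}.

Lemma prod_count_mem (F : 'I_n -> R) (s : seq 'I_n) :
  \prod_(i <- s) F i = \prod_t F t ^+ count_mem t s.
Proof.
elim: s => [|i s IH]; first by rewrite big_nil big1 // => t _; rewrite expr0.
rewrite big_cons IH [in RHS](bigD1 i) //= [in LHS](bigD1 i) //= eqxx exprS mulrA.
congr (_ * _); apply: eq_bigr => t /negbTE ti.
by rewrite eq_sym ti.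
Qed.

(* The moment of eps_{s_1} ... eps_{s_l} for i.i.d. variables with moments mu. *)
Definition word_moment (mu : nat -> R) (s : seq 'I_n) : R := \prod_t mu (count_mem t s).

(** Letters that do not occur contribute [mu 0 = 1]; what is left is a product that can be computed
    on a concrete word. *)
Lemma word_moment_undup mu s : mu 0%N = 1 ->
  word_moment mu s = \prod_(t <- undup s) mu (count_mem t s).
Proof.
move=> mu0; rewrite /word_moment (bigID (mem (undup s))) /= [X in _ * X]big1 ?mulr1.
  by rewrite -big_uniq ?undup_uniq.
by move=> t; rewrite mem_undup => /count_memPn ->.
Qed.

Lemma word_moment2 mu (i j : 'I_n) : mu 0%N = 1 -> mu 1%N = 0 ->
  word_moment mu [:: i; j] = mu 2%N * (i == j)%:R.
Proof.
move=> mu0 mu1; rewrite word_moment_undup //= !inE.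
case: (eqVneq i j) => [->|ij] /=.
  by rewrite big_seq1 eqxx mulr1.
by rewrite !big_cons big_nil !eqxx (eq_sym j i) (negbTE ij) /= !addn0 !add0n mu1 mul0r mulr0.
Qed.

(** The three pairings of Wick's formula, plus the fourth cumulant on words with a single letter,
    where the pairings alone give [3 * mu 2 ^+ 2]. Third moments do not appear because they come
    with a factor [mu 1 = 0]. *)
Lemma word_moment4 mu (i j k l : 'I_n) : mu 0%N = 1 -> mu 1%N = 0 ->
  word_moment mu [:: i; j; k; l] =
  mu 2%N ^+ 2 * ((i == j)%:R * (k == l)%:R + (i == k)%:R * (j == l)%:R
                 + (i == l)%:R * (j == k)%:R)
  + (mu 4%N - 3 * mu 2%N ^+ 2) * ((i == j)%:R * (i == k)%:R * (i == l)%:R).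
Proof.
move=> mu0 mu1; rewrite word_moment_undup //= !inE.
have [<-{j}|/negbTE ij] := eqVneq i j; have [<-{k}|/negbTE ik] := eqVneq i k;
have [<-{l}|/negbTE il] := eqVneq i l;
try (have [?|/negbTE jk] := eqVneq j k; first subst k);
try (have [?|/negbTE jl] := eqVneq j l; first subst l);
try (have [?|/negbTE kl] := eqVneq k l; first subst l).
all: by do_words mu1.
Qed.

Let pair_deltaE (p r : 'I_n * 'I_n) :
  (p.1 == r.1)%:R * (p.2 == r.2)%:R = (p == r)%:R :> R.
Proof. by case: p r => [i j] [k l]; rewrite xpair_eqE /= -natrM mulnb. Qed.

Let sum_delta (F : 'I_n * 'I_n -> R) p : \sum_r F r * (p == r)%:R = F p.
Proof.
rewrite (bigD1 p) //= eqxx mulr1 big1 ?addr0 // => r /negbTE rp.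
by rewrite eq_sym rp mulr0.
Qed.

Let mulr_le_avg (a b : R) : a * b <= (a ^+ 2 + b ^+ 2) / 2.
Proof. by have := sqr_ge0 (a - b); rewrite sqrrB; lra. Qed.

(** The left-hand side is the second moment of x'Qx about [mu 2 * \tr Q], expanded into words. The
    squared traces cancel; the two remaining pairings give [2 * C ^+ 2] and the fourth moment gives
    [C]. As [Q] may be asymmetric, the pairing with the transpose is bounded by the
    arithmetic-geometric mean inequality. *)
Lemma quadratic_variance_le (mu : nat -> R) (Q : 'M[R]_n) (C : R) :
  mu 0%N = 1 -> mu 1%N = 0 -> 0 <= mu 2%N <= C -> mu 4%N <= C ->
  \sum_p \sum_r Q p.1 p.2 * Q r.1 r.2 * word_moment mu [:: p.1; p.2; r.1; r.2]
   - 2 * mu 2%N * \tr Q * (\sum_p Q p.1 p.2 * word_moment mu [:: p.1; p.2])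
   + (mu 2%N * \tr Q) ^+ 2
  <= (2 * C ^+ 2 + C) * \sum_p Q p.1 p.2 ^+ 2.
Proof.
move=> mu0 mu1 /andP[m20 m2C] m4C; set S := \sum_p Q p.1 p.2 ^+ 2.
have trE : \sum_(p : 'I_n * 'I_n) Q p.1 p.2 * (p.1 == p.2)%:R = \tr Q.
  rewrite -(pair_big xpredT xpredT (fun i j => Q i j * (i == j)%:R)) /=.
  apply: eq_bigr => i _; rewrite (bigD1 i) //= eqxx mulr1 big1 ?addr0 // => j /negbTE ij.
  by rewrite eq_sym ij mulr0.
have -> : \sum_p Q p.1 p.2 * word_moment mu [:: p.1; p.2] = mu 2%N * \tr Q.
  rewrite -trE mulr_sumr; apply: eq_bigr => p _.
  by rewrite word_moment2 // mulrCA.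
(* The pairing of the first letter with the last matches an index pair with the swap of the
   other. *)
pose sw (p : 'I_n * 'I_n) := (p.2, p.1).
have swK : involutive sw by case.
pose T3 := \sum_p Q p.1 p.2 * Q p.2 p.1.
pose T4 := \sum_(p : 'I_n * 'I_n) Q p.1 p.2 ^+ 2 * (p.1 == p.2)%:R.
have -> : \sum_p \sum_r Q p.1 p.2 * Q r.1 r.2 * word_moment mu [:: p.1; p.2; r.1; r.2]
   = mu 2%N ^+ 2 * (\tr Q ^+ 2 + S + T3) + (mu 4%N - 3 * mu 2%N ^+ 2) * T4.
  have E1 : \tr Q ^+ 2 = \sum_p \sum_r
      Q p.1 p.2 * (p.1 == p.2)%:R * (Q r.1 r.2 * (r.1 == r.2)%:R).
    by rewrite expr2 -trE big_distrlr.
  have E2 : S = \sum_p \sum_r Q p.1 p.2 * Q r.1 r.2 * (p == r)%:R.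
    by apply: eq_bigr => p _; rewrite sum_delta expr2.
  have E3 : T3 = \sum_p \sum_r Q p.1 p.2 * Q r.1 r.2 * (sw p == r)%:R.
    by apply: eq_bigr => p _; rewrite sum_delta.
  have E4 : T4 = \sum_p \sum_r Q p.1 p.2 * Q r.1 r.2 * (p.1 == p.2)%:R * (p == r)%:R.
    by apply: eq_bigr => p _; rewrite sum_delta expr2.
  rewrite E1 E2 E3 E4 -!big_split /= !mulr_sumr -big_split /=; apply: eq_bigr => p _.
  rewrite -!big_split /= !mulr_sumr -big_split /=; apply: eq_bigr => r _.
  rewrite word_moment4 // -!pair_deltaE /=.
  have -> : (p.1 == p.2)%:R * (p.1 == r.1)%:R * (p.1 == r.2)%:R
      = (p.1 == p.2)%:R * ((p.1 == r.1)%:R * (p.2 == r.2)%:R) :> R.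
    by case: (eqVneq p.1 p.2) => [->|]; rewrite ?mulrA // !mul0r.
  by rewrite (mulrC (p.2 == r.1)%:R); ring.
have S0 : 0 <= S by apply: sumr_ge0 => p _; exact: sqr_ge0.
have T40 : 0 <= T4 by apply: sumr_ge0 => p _; rewrite mulr_ge0 // sqr_ge0.
have T4S : T4 <= S.
  apply: ler_sum => p _; rewrite ler_piMr ?sqr_ge0 //.
  by case: (_ == _); rewrite ?ler01 ?lexx.
have T3S : T3 <= S.
  apply: (@le_trans _ _ (\sum_p (Q p.1 p.2 ^+ 2 + Q p.2 p.1 ^+ 2) / 2)).
    by apply: ler_sum => p _; exact: mulr_le_avg.
  rewrite -mulr_suml big_split /=.
  have -> : \sum_(p : 'I_n * 'I_n) Q p.2 p.1 ^+ 2 = S.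
    by rewrite /S (reindex_inj (inv_inj swK)).
  by rewrite -/S; lra.
have m2sq : mu 2%N ^+ 2 <= C ^+ 2 by rewrite ler_sqr ?nnegrE //; lra.
have h1 : mu 2%N ^+ 2 * (S + T3) <= C ^+ 2 * (S + S).
  apply: (@le_trans _ _ (mu 2%N ^+ 2 * (S + S))).
    by rewrite ler_wpM2l ?sqr_ge0 // lerD2l.
  by rewrite ler_wpM2r // addr_ge0.
have h2 : (mu 4%N - 3 * mu 2%N ^+ 2) * T4 <= C * S.
  apply: (@le_trans _ _ (C * T4)); last by rewrite ler_wpM2l //; lra.
  rewrite ler_wpM2r //; have := sqr_ge0 (mu 2%N); lra.
rewrite exprMn -[X in X <= _]/(_ - _ + _).
have -> : mu 2%N ^+ 2 * (\tr Q ^+ 2 + S + T3) + (mu 4%N - 3 * mu 2%N ^+ 2) * T4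
   - 2 * mu 2%N * \tr Q * (mu 2%N * \tr Q) + mu 2%N ^+ 2 * \tr Q ^+ 2
  = mu 2%N ^+ 2 * (S + T3) + (mu 4%N - 3 * mu 2%N ^+ 2) * T4 by ring.
have -> : (2 * C ^+ 2 + C) * S = C ^+ 2 * (S + S) + C * S by ring.
exact: lerD.
Qed.
End WordMoments.

(** Markov's inequality, with the lower bound asked only on [E]: below, [f] is a squared deviation
    times the indicator of an event. *)
Lemma probability_le_integral d (T : measurableType d) (R : realType)
    (P : probability T R) (E : set T) (f : T -> R) (del B : R) :
  measurable E -> measurable_fun setT f -> 0 < del ->
  (forall w, 0 <= f w) -> (forall w, E w -> del <= f w) ->
  (\int[P]_w (f w)%:E <= B%:E)%E -> (P E <= (B / del)%:E)%E.
Proof.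
move=> mE mf del0 f0 fE fB.
have : (del%:E * P E <= B%:E)%E.
  apply: le_trans fB; rewrite -[E in P E]setIT -integral_indic // -ge0_integralZl //.
  - apply: ge0_le_integral => //.
    + by move=> w _; rewrite mule_ge0 // lee_fin // ltW.
    + by apply: measurable_funeM; apply/measurable_EFinP; exact: measurable_indic.
    + exact/measurable_EFinP.
    move=> w _; rewrite -EFinM lee_fin indicE; case: (boolP (w \in E)) => [wE|_].
      by rewrite mulr1 fE //; move: wE; rewrite inE.
    by rewrite mulr0.
  - by apply/measurable_EFinP; exact: measurable_indic.
  - by rewrite lee_fin ltW.
have fn : P E \is a fin_num by exact: fin_num_measure.
by rewrite -(fineK fn) -EFinM !lee_fin ler_pdivlMr // mulrC.
Qed.

(** * Conditional Chebyshev inequalities *)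

Section ConditionalMoments.
Context {d d' : measure_display} {Om : measurableType d} {W : measurableType d'}.
Context {R : realType} (P : probability Om R).
Variables (pi : Om -> W) (kap : W -> probability R R) (n : nat) (eps : 'I_n -> Om -> R).
Hypothesis mpi : measurable_fun setT pi.
Hypothesis mkap : forall B, measurable B -> measurable_fun setT (fun w => kap w B).
Hypothesis meps : forall t, measurable_fun setT (eps t).
Hypothesis law : forall (A : set W) (B : 'I_n -> set R),
  measurable A -> (forall t, measurable (B t)) ->
  P ((pi @^-1` A) `&` [set w | forall t, B t (eps t w)])
  = (\int[P]_(w in pi @^-1` A) \prod_(t < n) kap (pi w) (B t))%E.

Definition cpow (w : W) (k : nat) : R := cmom kap (fun x => x ^+ k) w.

Lemma measurable_cpow k : measurable_fun setT (fun w => cpow w k).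
Proof. by apply: measurable_cmom => //; exact: exprn_measurable. Qed.

Lemma cpow0 w : cpow w 0 = 1.
Proof.
rewrite /cpow /cmom; under eq_integral do rewrite expr0.
by rewrite integral_cst // (_ : _ [set: R] = 1%E) ?mule1 //; exact: probability_setT.
Qed.

(** Through this domination a single bound on the fourth moment controls every factor of a word of
    length at most 4; it is the source of [1 + L] below. *)
Let pow_le4 (x : R) k : (k <= 4)%N -> `|x ^+ k| <= 1 + x ^+ 4.
Proof.
move=> k4; have -> : x ^+ 4 = `|x| ^+ 4 by rewrite -normrX ger0_norm // (exprM x 2 2) sqr_ge0.
rewrite normrX; have [x1|x1] := leP `|x| 1.
  by apply: (@le_trans _ _ 1); [exact: exprn_ile1|rewrite lerDl exprn_ge0].
by apply: (@le_trans _ _ (`|x| ^+ 4)); [rewrite ler_weXn2l // ltW|rewrite lerDr].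
Qed.

Let word_bounded (g : W -> R) (L : R) (s : seq 'I_n) : measurable_fun setT g ->
  (forall w, `|g w| <= L) ->
  (forall w, g w != 0 -> (\int[kap w]_x (x ^+ 4)%:E <= L%:E)%E) ->
  (size s <= 4)%N ->
  cond_bounded kap (1 + L) g (fun t x => x ^+ count_mem t s).
Proof.
move=> mg gL g4 s4; split => //.
  by move=> w; apply: le_trans (gL w) _; rewrite lerDr.
move=> w t gw.
have m4 : measurable_fun setT (fun x : R => (x ^+ 4)%:E).
  by apply/measurable_EFinP; exact: exprn_measurable.
have p4 (x : R) : 0 <= x ^+ 4 by rewrite (exprM x 2 2) sqr_ge0.
apply: (@le_trans _ _ (\int[kap w]_x (1 + (x ^+ 4)%:E)%E)%E).
  apply: ge0_le_integral => //.
  - apply/measurable_EFinP; apply: measurableT_comp => //; exact: exprn_measurable.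
  - exact: emeasurable_funD.
  move=> x _; rewrite -EFinD lee_fin pow_le4 //.
  by apply: leq_trans (count_size _ _) s4.
rewrite ge0_integralD //; last by move=> x _; rewrite lee_fin.
rewrite integral_cst // (_ : _ [set: R] = 1%E) ?mule1 //; last exact: probability_setT.
by rewrite EFinD leeD2l // g4.
Qed.

(** A polynomial in the errors with coefficients depending on the regressors: monomials are words,
    and grouping equal letters makes each one a product of functions of separate errors. *)
Lemma cond_poly (I : finType) (G : I -> W -> R) (s : I -> seq 'I_n) (L : R) :
  (forall a, measurable_fun setT (G a)) -> (forall a w, `|G a w| <= L) ->
  (forall a w, G a w != 0 -> (\int[kap w]_x (x ^+ 4)%:E <= L%:E)%E) ->
  (forall a, (size (s a) <= 4)%N) ->
  (\int[P]_w (\sum_a G a (pi w) * \prod_(i <- s a) eps i w)%:E =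
   \int[P]_w (\sum_a G a (pi w) * word_moment (cpow (pi w)) (s a))%:E)%E.
Proof.
move=> mG GL G4 s4.
have hb a := word_bounded (mG a) (GL a) (G4 a) (s4 a).
under eq_integral do rewrite -sumEFin.
rewrite integral_sum //; last first.
  move=> a; rewrite (_ : (fun w => _) = EFin \o (fun w =>
      G a (pi w) * \prod_t eps t w ^+ count_mem t (s a))).
    by have := integrable_prod mpi mkap meps law (hb a).
  by apply/funext => w /=; rewrite prod_count_mem.
under [in RHS]eq_integral do rewrite -sumEFin.
rewrite [in RHS]integral_sum //; last first.
  by move=> a; have := integrable_cmom_prod P mpi mkap (hb a).
apply: eq_bigr => a _; rewrite -(cond_prod mpi mkap meps law (hb a)).
by apply: eq_integral => w _; rewrite prod_count_mem.
Qed.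

Let indw (A : set W) (w : W) : R := \1_A w.

Let indw_neq0 (A : set W) x w : indw A w * x != 0 -> A w.
Proof.
rewrite /indw indicE; case: (boolP (w \in A)) => [|_]; first by rewrite inE.
by rewrite mul0r eqxx.
Qed.

Let indw_norm (A : set W) (x L : R) w : 0 <= L -> (A w -> `|x| <= L) -> `|indw A w * x| <= L.
Proof.
move=> L0 xL; rewrite /indw indicE; case: (boolP (w \in A)) => [|_].
  by rewrite inE mul1r; exact: xL.
by rewrite mul0r normr0.
Qed.

Let indw_le (A : set W) (x L : R) w : 0 <= L -> (A w -> x <= L) -> indw A w * x <= L.
Proof.
move=> L0 xL; rewrite /indw indicE; case: (boolP (w \in A)) => [|_].
  by rewrite inE mul1r; exact: xL.
by rewrite mul0r.
Qed.

Lemma measurable_preimT d1 d2 (T1 : measurableType d1) (T2 : measurableType d2)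
    (f : T1 -> T2) (B : set T2) : measurable_fun setT f -> measurable B ->
  measurable (f @^-1` B).
Proof. by move=> mf mB; rewrite -[X in measurable X]setTI; exact: mf. Qed.

Lemma measurable_norm_gt d1 (T1 : measurableType d1) (f : T1 -> R) (a : R) :
  measurable_fun setT f -> measurable [set w | a < `|f w|].
Proof.
move=> mf; rewrite (_ : mkset _ = (fun w => `|f w|) @^-1` `]a, +oo[%classic); last first.
  by apply/seteqP; split => w /=; rewrite in_itv /= andbT.
by apply: measurable_preimT => //; exact: measurableT_comp.
Qed.

Let int_le_cst (f : Om -> R) (B : R) : P.-integrable setT (EFin \o f) ->
  (forall w, f w <= B) -> (\int[P]_w (f w)%:E <= B%:E)%E.
Proof.
move=> mf fB; apply: (@le_trans _ _ (\int[P]_w B%:E)%E).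
  apply: le_integral => //.
    by apply: (@finite_measure_integrable_cst _ _ _ P setT B).
  by move=> w _; rewrite lee_fin.
by rewrite integral_cst // (_ : _ [set: Om] = 1%E) ?mule1 //; exact: probability_setT.
Qed.

Lemma cond_poly_le (I : finType) (G : I -> W -> R) (s : I -> seq 'I_n) (L B : R) :
  (forall a, measurable_fun setT (G a)) -> (forall a w, `|G a w| <= L) ->
  (forall a w, G a w != 0 -> (\int[kap w]_x (x ^+ 4)%:E <= L%:E)%E) ->
  (forall a, (size (s a) <= 4)%N) ->
  (forall w, \sum_a G a w * word_moment (cpow w) (s a) <= B) ->
  (\int[P]_w (\sum_a G a (pi w) * \prod_(i <- s a) eps i w)%:E <= B%:E)%E.
Proof.
move=> mG GL G4 s4 GB; rewrite (cond_poly mG GL G4 s4); apply: int_le_cst => //.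
rewrite (_ : _ \o _ = fun w => \sum_a (G a (pi w) * word_moment (cpow (pi w)) (s a))%:E)%E.
  apply: integrable_sum => // a _.
  by have := integrable_cmom_prod P mpi mkap (word_bounded (mG a) (GL a) (G4 a) (s4 a)).
by apply/funext => w /=; rewrite sumEFin.
Qed.

Lemma quadratic_chebyshev (Q : W -> 'M[R]_n) (A : set W) (b C del : R) :
  measurable A -> (forall i j, measurable_fun setT (fun w => Q w i j)) ->
  0 < del -> 0 <= b -> 0 <= C ->
  (forall w, A w -> \sum_p Q w p.1 p.2 ^+ 2 <= b) ->
  (forall w, A w -> (\int[kap w]_x (x ^+ 4)%:E <= C%:E)%E) ->
  (forall w, A w -> cpow w 1 = 0) -> (forall w, A w -> 0 <= cpow w 2 <= C) ->
  (P (pi @^-1` A `&` [set w | (del <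
     `|(\sum_p Q (pi w) p.1 p.2 * (eps p.1 w * eps p.2 w))
       - cpow (pi w) 2 * \tr (Q (pi w))|)%R])
   <= ((2 * C ^+ 2 + C) * b / del ^+ 2)%:E)%E.
Proof.
move=> mA mQ del0 b0 C0 Qb A4 A1 A2.
have mtr : measurable_fun setT (fun w => \tr (Q w)).
  by apply: measurable_sum => i; exact: mQ.
have m2 : measurable_fun setT (fun w => cpow w 2) by exact: measurable_cpow.
have mI : measurable_fun setT (indw A) by exact: measurable_indic.
(* A crude entry bound from [z <= 1 + z ^+ 2], used for integrability alone. *)
have Qle w i j : A w -> `|Q w i j| <= 1 + b.
  move=> Aw; have : `|Q w i j| ^+ 2 <= b.
    rewrite -normrX ger0_norm ?sqr_ge0 //; apply: le_trans (Qb w Aw).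
    by rewrite (bigD1 (i, j)) //= lerDl sumr_ge0 // => p _; exact: sqr_ge0.
  have := sqr_ge0 (`|Q w i j| - 1); rewrite sqrrB; have := normr_ge0 (Q w i j); nra.
pose t := n%:R * (1 + b).
have t0 : 0 <= t by rewrite mulr_ge0 // addr_ge0.
have trle w : A w -> `|\tr (Q w)| <= t.
  move=> Aw; apply: le_trans (ler_norm_sum _ _ _) _.
  rewrite /t mulr_natl -[X in _ *+ X](card_ord n) -sumr_const.
  by apply: ler_sum => i _; exact: Qle.
(* The expanded square has monomials of degree 4, 2 and 0, hence an index type with three summands;
   the indicator of [A] is part of each coefficient. *)
pose G (a : ('I_n * 'I_n) * ('I_n * 'I_n) + ('I_n * 'I_n) + unit) (w : W) : R :=
  indw A w * match a with
  | inl (inl (p, r)) => Q w p.1 p.2 * Q w r.1 r.2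
  | inl (inr p) => - 2 * cpow w 2 * \tr (Q w) * Q w p.1 p.2
  | inr _ => (cpow w 2 * \tr (Q w)) ^+ 2
  end.
pose s (a : ('I_n * 'I_n) * ('I_n * 'I_n) + ('I_n * 'I_n) + unit) : seq 'I_n :=
  match a with
  | inl (inl (p, r)) => [:: p.1; p.2; r.1; r.2]
  | inl (inr p) => [:: p.1; p.2]
  | inr _ => [::]
  end.
have GE w (F : seq 'I_n -> R) : F [::] = 1 -> \sum_a G a w * F (s a) = indw A w *
    (\sum_p \sum_r Q w p.1 p.2 * Q w r.1 r.2 * F [:: p.1; p.2; r.1; r.2]
     - 2 * cpow w 2 * \tr (Q w) * (\sum_p Q w p.1 p.2 * F [:: p.1; p.2])
     + (cpow w 2 * \tr (Q w)) ^+ 2).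
  move=> F0; rewrite !big_sumType /= (big_pred1 tt) /=; last by case.
  rewrite F0 mulr1 mulrDr mulrBr; congr (_ + _ + _).
    rewrite pair_big /= mulr_sumr; apply: eq_bigr => -[p r] _.
    by rewrite /G /= !mulrA.
  rewrite (mulrA (indw A w)) [X in _ = - X]mulr_sumr -sumrN.
  by apply: eq_bigr => p _; rewrite /G /=; ring.
(* One constant dominating all coefficients and the fourth moment. It grows with [n] through [t],
   but it only certifies integrability and does not enter the final bound. *)
pose L := C + (1 + b) * (1 + b) + 2 * C * t * (1 + b) + (C * t) ^+ 2.
have L1 : 0 <= (1 + b) * (1 + b) by rewrite mulr_ge0 // addr_ge0.
have L2 : 0 <= 2 * C * t * (1 + b) by rewrite !mulr_ge0 // addr_ge0.
have L3 : 0 <= (C * t) ^+ 2 by exact: sqr_ge0.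
have m2le w : A w -> `|cpow w 2| <= C.
  by move=> Aw; have /andP[? ?] := A2 w Aw; rewrite ger0_norm.
pose f w := \sum_a G a (pi w) * \prod_(i <- s a) eps i w.
have fE w : f w = indw A (pi w) *
    ((\sum_p Q (pi w) p.1 p.2 * (eps p.1 w * eps p.2 w)) - cpow (pi w) 2 * \tr (Q (pi w))) ^+ 2.
  rewrite /f (GE (pi w) (fun s => \prod_(i <- s) eps i w)) ?big_nil //; congr (_ * _).
  rewrite sqrrB [in RHS]expr2 big_distrlr /=; congr (_ - _ + _).
    apply: eq_bigr => p _; apply: eq_bigr => r _.
    by rewrite !big_cons big_nil; ring.
  under eq_bigr do rewrite !big_cons big_nil mulr1.
  by rewrite -mulr_natl; ring.
have mf : measurable_fun setT f.
  apply: (@eq_measurable_fun _ _ _ _ setT (fun w => indw A (pi w) *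
    ((\sum_p Q (pi w) p.1 p.2 * (eps p.1 w * eps p.2 w)) - cpow (pi w) 2 * \tr (Q (pi w))) ^+ 2)).
    by move=> w _; rewrite fE.
  apply: measurable_funM; first exact: measurableT_comp.
  apply: measurable_funX; apply: measurable_funB.
    apply: measurable_sum => p; apply: measurable_funM; last exact: measurable_funM.
    by apply: (measurableT_comp (mQ p.1 p.2)).
  by apply: measurable_funM; [apply: (measurableT_comp m2)|apply: (measurableT_comp mtr)].
apply: (@probability_le_integral _ _ _ P _ f) => //.
- apply: measurableI; first exact: measurable_preimT.
  apply: measurable_norm_gt; apply: measurable_funB.
    apply: measurable_sum => p; apply: measurable_funM; last exact: measurable_funM.
    by apply: (measurableT_comp (mQ p.1 p.2)).
  by apply: measurable_funM; [apply: (measurableT_comp m2)|apply: (measurableT_comp mtr)].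
- by rewrite exprn_gt0.
- by move=> w; rewrite fE mulr_ge0 // sqr_ge0.
- move=> w [Aw /= dw]; rewrite fE /indw indicE mem_set // mul1r -[leRHS]real_normK ?num_real //.
  by rewrite ler_sqr ?nnegrE ?normr_ge0 // ltW.
apply: (@cond_poly_le _ G s L).
- move=> a; apply: measurable_funM => //.
  case: a => [[[p r]|p]|[]].
  + exact: measurable_funM.
  + by do 2 apply: measurable_funM => //; exact: measurable_funM.
  + by apply: measurable_funX; exact: measurable_funM.
- move=> a w; apply: indw_norm; first by rewrite /L; lra.
  move=> Aw; case: a => [[[p r]|p]|[]].
  + apply: (@le_trans _ _ ((1 + b) * (1 + b))); last by rewrite /L; lra.
    by rewrite normrM ler_pM // Qle.
  + apply: (@le_trans _ _ (2 * C * t * (1 + b))); last by rewrite /L; lra.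
    rewrite !normrM normrN (ger0_norm (ler0n _ 2)).
    by rewrite !ler_pM ?mulr_ge0 // ?Qle ?trle ?m2le.
  + apply: (@le_trans _ _ ((C * t) ^+ 2)); last by rewrite /L; lra.
    rewrite normrX ler_sqr ?nnegrE ?normr_ge0 //; last exact: mulr_ge0.
    by rewrite normrM ler_pM // ?m2le ?trle.
- move=> a w /indw_neq0 Aw; apply: le_trans (A4 w Aw) _; rewrite lee_fin /L; lra.
- by case=> [[[p r]|p]|[]].
move=> w; rewrite (GE w (word_moment (cpow w))); last first.
  by rewrite /word_moment big1 // => i _; exact: cpow0.
have K0 : 0 <= 2 * C ^+ 2 + C by rewrite addr_ge0 // mulr_ge0 // sqr_ge0.
apply: indw_le; first by rewrite mulr_ge0.
move=> Aw; apply: le_trans (quadratic_variance_le (Q w) (cpow0 w) (A1 w Aw) (A2 w Aw) _) _.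
  have : (\int[kap w]_x (x ^+ 4)%:E \is a fin_num)%E.
    rewrite ge0_fin_numE; first by apply: le_lt_trans (A4 w Aw) (ltry _).
    by apply: integral_ge0 => x _; rewrite lee_fin (exprM x 2 2) sqr_ge0.
  by move=> fn; rewrite -lee_fin /cpow /cmom fineK // A4.
by rewrite ler_wpM2l // Qb.
Qed.

Lemma linear_chebyshev (q : W -> 'I_n -> R) (A : set W) (b C del : R) :
  measurable A -> (forall i, measurable_fun setT (fun w => q w i)) ->
  0 < del -> 0 <= b -> 0 <= C ->
  (forall w, A w -> \sum_i q w i ^+ 2 <= b) ->
  (forall w, A w -> (\int[kap w]_x (x ^+ 4)%:E <= C%:E)%E) ->
  (forall w, A w -> cpow w 1 = 0) -> (forall w, A w -> 0 <= cpow w 2 <= C) ->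
  (P (pi @^-1` A `&` [set w | (del < `|\sum_i q (pi w) i * eps i w|)%R])
   <= (C * b / del ^+ 2)%:E)%E.
Proof.
move=> mA mq del0 b0 C0 qb A4 A1 A2.
have mI : measurable_fun setT (indw A) by exact: measurable_indic.
have qle w i : A w -> `|q w i| <= 1 + b.
  move=> Aw; have : `|q w i| ^+ 2 <= b.
    rewrite -normrX ger0_norm ?sqr_ge0 //; apply: le_trans (qb w Aw).
    by rewrite (bigD1 i) //= lerDl sumr_ge0 // => p _; exact: sqr_ge0.
  have := sqr_ge0 (`|q w i| - 1); rewrite sqrrB; have := normr_ge0 (q w i); nra.
pose G (p : 'I_n * 'I_n) (w : W) : R := indw A w * (q w p.1 * q w p.2).
pose L := C + (1 + b) * (1 + b).
have L1 : 0 <= (1 + b) * (1 + b) by rewrite mulr_ge0 // addr_ge0.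
pose f w := \sum_p G p (pi w) * \prod_(i <- [:: p.1; p.2]) eps i w.
have fE w : f w = indw A (pi w) * (\sum_i q (pi w) i * eps i w) ^+ 2.
  rewrite /f expr2 big_distrlr /= pair_big mulr_sumr; apply: eq_bigr => -[i j] _ /=.
  by rewrite /G !big_cons big_nil /=; ring.
have ml : measurable_fun setT (fun w => \sum_i q (pi w) i * eps i w).
  by apply: measurable_sum => i; apply: measurable_funM => //; apply: (measurableT_comp (mq i)).
have mf : measurable_fun setT f.
  apply: (@eq_measurable_fun _ _ _ _ setT
    (fun w => indw A (pi w) * (\sum_i q (pi w) i * eps i w) ^+ 2)).
    by move=> w _; rewrite fE.
  by apply: measurable_funM; [exact: measurableT_comp|exact: measurable_funX].
apply: (@probability_le_integral _ _ _ P _ f) => //.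
- by apply: measurableI; [exact: measurable_preimT|exact: measurable_norm_gt].
- by rewrite exprn_gt0.
- by move=> w; rewrite fE mulr_ge0 // sqr_ge0.
- move=> w [Aw /= dw]; rewrite fE /indw indicE mem_set // mul1r -[leRHS]real_normK ?num_real //.
  by rewrite ler_sqr ?nnegrE ?normr_ge0 // ltW.
apply: (@cond_poly_le _ G (fun p => [:: p.1; p.2]) L) => //.
- by move=> p; apply: measurable_funM => //; exact: measurable_funM.
- move=> p w; apply: indw_norm; first by rewrite /L addr_ge0.
  move=> Aw; apply: (@le_trans _ _ ((1 + b) * (1 + b))); last by rewrite /L lerDr.
  by rewrite normrM ler_pM // qle.
- move=> p w /indw_neq0 Aw; apply: le_trans (A4 w Aw) _.
  by rewrite lee_fin /L lerDl.
move=> w.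
have -> : \sum_p G p w * word_moment (cpow w) [:: p.1; p.2]
    = indw A w * \sum_p q w p.1 * q w p.2 * word_moment (cpow w) [:: p.1; p.2].
  by rewrite mulr_sumr; apply: eq_bigr => p _; rewrite /G !mulrA.
apply: indw_le; first exact: mulr_ge0.
move=> Aw; have /andP[m0 mC] := A2 w Aw.
rewrite -(pair_big xpredT xpredT (fun i j => q w i * q w j * word_moment (cpow w) [:: i; j])) /=.
have -> : \sum_i \sum_j q w i * q w j * word_moment (cpow w) [:: i; j]
    = cpow w 2 * \sum_i q w i ^+ 2.
  rewrite mulr_sumr; apply: eq_bigr => i _; rewrite (bigD1 i) //= big1 => [|j ji].
    by rewrite (word_moment2 _ _ (cpow0 w) (A1 w Aw)) eqxx mulr1 addr0; ring.
  by rewrite (word_moment2 _ _ (cpow0 w) (A1 w Aw)) eq_sym (negbTE ji) !mulr0.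
by rewrite ler_pM // ?qb // sumr_ge0 // => i _; exact: sqr_ge0.
Qed.
End ConditionalMoments.


(** * Quadratic forms in the lagged and the current errors *)

Section Selection.
Context {R : realFieldType}.

Definition selmx (m n : nat) (f : 'I_m -> 'I_n) : 'M[R]_(m, n) :=
  \matrix_(i, a) (f i == a)%:R.

Lemma selmx_mul m n p (f : 'I_m -> 'I_n) (x : 'M[R]_(n, p)) i j :
  (selmx f *m x) i j = x (f i) j.
Proof.
rewrite mxE (bigD1 (f i)) //= mxE eqxx mul1r big1 ?addr0 // => a /negbTE fa.
by rewrite mxE eq_sym fa mul0r.
Qed.

Lemma selmx_mul_tr m m' n (f : 'I_m -> 'I_n) (g : 'I_m' -> 'I_n) i j :
  (selmx f *m (selmx g)^T) i j = (g j == f i)%:R.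
Proof. by rewrite selmx_mul !mxE. Qed.

Lemma selmx_inj m n (f : 'I_m -> 'I_n) : injective f -> selmx f *m (selmx f)^T = 1%:M.
Proof.
by move=> fI; apply/matrixP => i j; rewrite selmx_mul_tr mxE (inj_eq fI) eq_sym.
Qed.

Lemma qform_mx00 n (Q : 'M[R]_n) (x : 'cV[R]_n) :
  (x^T *m Q *m x) 0 0 = \sum_p Q p.1 p.2 * (x p.1 0 * x p.2 0).
Proof.
rewrite mxE -(pair_big xpredT xpredT (fun i j => Q i j * (x i 0 * x j 0))) /= exchange_big /=.
apply: eq_bigr => j _; rewrite mxE mulr_suml; apply: eq_bigr => i _.
by rewrite mxE; ring.
Qed.

Lemma mxtrace_mul_tr n (Q : 'M[R]_n) : \tr (Q *m Q^T) = \sum_p Q p.1 p.2 ^+ 2.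
Proof.
rewrite -(pair_big xpredT xpredT (fun i j => Q i j ^+ 2)) /=.
by apply: eq_bigr => i _; rewrite mxE; apply: eq_bigr => j _; rewrite mxE expr2.
Qed.

(* The errors eps_0, ..., eps_T form one vector x; the current and the lagged ones are
   selmx f *m x for two injections f, so that a form mixing them is a quadratic form in x. *)
Definition pullmx (m n : nat) (f g : 'I_m -> 'I_n) (M : 'M[R]_m) : 'M[R]_n :=
  (selmx f)^T *m M *m selmx g.

(** Injectivity gives [selmx f *m (selmx f)^T = 1], so embedding keeps the Frobenius norm; for an
    annihilator this norm squared is its trace. *)
Lemma pullmx_sqnorm m n (f g : 'I_m -> 'I_n) (M : 'M[R]_m) :
  injective f -> injective g ->
  \sum_p pullmx f g M p.1 p.2 ^+ 2 = \tr (M *m M^T).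
Proof.
move=> fI gI; rewrite -mxtrace_mul_tr /pullmx !trmx_mul trmxK.
rewrite mxtrace_mulC !mulmxA -(mulmxA _ (selmx f)) selmx_inj // mulmx1.
by rewrite mxtrace_mulC !mulmxA selmx_inj // mul1mx mxtrace_mulC.
Qed.

(** This trace is the centring in Chebyshev's inequality: the trace of [M] when [f = g] is
    injective, the subdiagonal sum when lagged errors meet current ones. *)
Lemma pullmx_trace m n (f g : 'I_m -> 'I_n) (M : 'M[R]_m) :
  \tr (pullmx f g M) = \sum_i \sum_(j | g j == f i) M i j.
Proof.
rewrite /pullmx -mulmxA mxtrace_mulC -mulmxA.
apply: eq_bigr => i _; rewrite mxE [in RHS]big_mkcond; apply: eq_bigr => j _.
by rewrite selmx_mul_tr eq_sym; case: (_ == _); rewrite ?mulr1 ?mulr0.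
Qed.

Lemma pullmx_qform m n (f g : 'I_m -> 'I_n) (M : 'M[R]_m) (x : 'cV[R]_n) :
  ((selmx f *m x)^T *m M *m (selmx g *m x)) 0 0 =
  \sum_p pullmx f g M p.1 p.2 * (x p.1 0 * x p.2 0).
Proof. by rewrite -qform_mx00 /pullmx trmx_mul !mulmxA. Qed.

(** By symmetry and idempotence a diagonal entry is the sum of squares of its row. It thus dominates
    its own square, so it is at most 1, and it dominates the square of every entry of the row. *)
Lemma annih_entry_le n k (A : 'M[R]_(n, k)) i j : \rank A = k -> `|annih A i j| <= 1.
Proof.
move=> rA; have sy p q : annih A q p = annih A p q by rewrite -{1}annih_sym mxE.
have MM l : annih A l l = \sum_j annih A l j ^+ 2.
  rewrite -{1}(annih_idem rA) mxE; apply: eq_bigr => j' _.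
  by rewrite expr2 (sy l).
have d0 l : 0 <= annih A l l by rewrite MM sumr_ge0 // => ? _; exact: sqr_ge0.
have le l j' : annih A l j' ^+ 2 <= annih A l l.
  by rewrite [leRHS]MM (bigD1 j') //= lerDl sumr_ge0 // => ? _; exact: sqr_ge0.
have d1 l : annih A l l <= 1.
  by have := le l l; have := d0 l; nra.
have := le i j; have := d1 i; rewrite -(@ler_sqr _ `|_|) ?nnegrE // => h1 h2.
by rewrite -normrX ger0_norm ?sqr_ge0 // expr1n; apply: le_trans h2 h1.
Qed.

(** Each row holds at most one subdiagonal entry, and row 0 holds none. *)
Lemma subdiag_sum_le n k (A : 'M[R]_(n, k)) : \rank A = k ->
  `|\sum_(i < n) \sum_(j < n | j.+1 == i) annih A i j| <= n%:R.
Proof.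
move=> rA; apply: le_trans (ler_norm_sum _ _ _) _.
rewrite -[X in X%:R](card_ord n) -sumr_const; apply: ler_sum => i _.
case: i => -[|i] ilt /=; first by rewrite big_pred0 // normr0.
rewrite (big_pred1 (Ordinal (ltnW ilt))) => [|j]; last by rewrite eqSS.
exact: annih_entry_le.
Qed.
End Selection.

(** Passage to the variables of [err_bound_scaled]: quadratic forms and [S] are divided by [m], [ta]
    is multiplied by it, and the linear forms [p] and [ph] are kept. *)
Lemma resid_ratio_rescale (R : fieldType) (ph ta ff F W p S m s : R) :
  (1 + ph) ^+ 2 + ta * ff != 0 -> 1 + ta * m * s != 0 -> m != 0 -> s != 0 ->
  (W + (ff * p ^+ 2 - ta * F ^+ 2 - 2 * (1 + ph) * F * p)
         / ((1 + ph) ^+ 2 + ta * ff)) / m / s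
   - (1 - s * (ta / (1 + s * m * ta)) / m * S ^+ 2) =
  (W / m + (ff / m * p ^+ 2 - ta * m * (F / m) ^+ 2 - 2 * (1 + ph) * (F / m) * p)
         / ((1 + ph) ^+ 2 + ta * m * (ff / m))) / s
   - (1 - s * (ta * m) * (S / m) ^+ 2 / (1 + ta * m * s)).
Proof.
move=> D1 D2 m1 s1.
have -> : ta * m * (ff / m) = ta * ff by field.
have D3 : 1 + s * m * ta != 0 by apply: contraNneq D2 => <-; apply/eqP; ring.
by field; rewrite ?s1 ?m1 ?D1 ?D2 ?D3.
Qed.

(** The scaled bound applies with [b = tau * m], at most [B] because [m <= n], and with
    [kap = c^-1], because the subdiagonal sum is at most [n] in absolute value and [c * n < m]. *)
Lemma resid_ratio_error (R : realFieldType) (c C B eta s : R) n k (A : 'M[R]_(n, k))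
    (e u : 'cV[R]_n) (al b : 'cV[R]_k) (m := (n - k)%:R : R)
    (S := \sum_(i < n) \sum_(j < n | j.+1 == i) annih A i j)
    (X := A + e *m al^T) (y := X *m b + u) :
  0 < c -> c < s < C -> 0 <= B -> 0 <= eta <= 2^-1 -> \rank A = k ->
  c * n%:R < m -> n%:R * pert_norm A al <= B ->
  `|(u^T *m annih A *m u) 0 0 - s * m| <= eta * m ->
  `|(e^T *m annih A *m e) 0 0 - s * m| <= eta * m ->
  `|(e^T *m annih A *m u) 0 0 - s * S| <= eta * m ->
  `|((pert_dir A al)^T *m u) 0 0| <= eta -> `|((pert_dir A al)^T *m e) 0 0| <= eta ->
  `|(y^T *m annih X *m y) 0 0 / m / s
    - (1 - s * (al^T *m invmx (A^T *m A + (s * m) *: (al *m al^T)) *m al) 0 0 / m * S ^+ 2)|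
  <= err_const c C B c^-1 * eta.
Proof.
move=> c0 /andP[cs sC] B0 /andP[eta0 eta2] rA cm tB WE xE GE pE phiE.
have n0 : 0 <= n%:R :> R by [].
have m0 : 0 < m by apply: le_lt_trans cm; rewrite mulr_ge0 // ltW.
have s0 : 0 < s by apply: lt_trans c0 cs.
have mn : m <= n%:R by rewrite ler_nat leq_subr.
have tau0 : 0 <= pert_norm A al by exact: pert_norm_ge0.
have ff0 : 0 <= (e^T *m annih A *m e) 0 0.
  rewrite -(annih_idem rA) mulmxA -{1}annih_sym -trmx_mul -mulmxA.
  exact: sqnorm_mx00_ge0.
have scale z t : `|z - t * m| <= eta * m -> `|z / m - t| <= eta.
  move=> h; rewrite -(ler_pM2r m0) -[X in _ * X <= _](gtr0_norm m0) -normrM mulrBl divfK //.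
  by rewrite gt_eqF.
have hS : `|S / m| <= c^-1.
  rewrite normrM normfV (gtr0_norm m0) ler_pdivrMr // mulrC ler_pdivlMr //.
  by apply: le_trans (ltW cm); rewrite mulrC ler_wpM2l ?(ltW c0) // subdiag_sum_le.
have D0 : pert_det A e al != 0.
  rewrite /pert_det /pert_rss gt_eqF // ltr_pwDl ?mulr_ge0 // exprn_gt0 //.
  by move: phiE; rewrite -/(pert_proj A e al) ler_norml => /andP[? ?]; lra.
have sm0 : 0 <= s * m by rewrite mulr_ge0 // ltW.
rewrite (pert_norm_shrunk al rA sm0) /y /X (resid_rank_one_perturbation rA b u D0).
have D1 : (1 + pert_proj A e al) ^+ 2 + pert_norm A al * (e^T *m annih A *m e) 0 0 != 0 by [].
have D2 : 1 + pert_norm A al * m * s != 0.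
  by rewrite gt_eqF // ltr_wpDr // !mulr_ge0 // ltW.
have GE' : `|(e^T *m annih A *m u) 0 0 / m - s * (S / m)| <= eta.
  by apply: scale; rewrite -mulrA divfK // gt_eqF.
have bB : 0 <= pert_norm A al * m <= B.
  rewrite mulr_ge0 ?(ltW m0) //=; apply: le_trans tB.
  by rewrite mulrC ler_wpM2r.
have := err_bound_scaled c0 cs sC bB _ _ _ hS (scale _ _ WE) (scale _ _ xE) GE' pE phiE.
rewrite invr_ge0 (ltW c0) eta0 eta2 divr_ge0 ?(ltW m0) // => /(_ isT isT isT).
apply: le_trans; rewrite le_eqVlt; apply/orP; left; apply/eqP; congr (`|_|).
rewrite /pert_det /pert_rss -!/(pert_proj A e al).
by apply: resid_ratio_rescale => //; exact: lt0r_neq0.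
Qed.


(** * Measurability of matrix functions *)

(** Inversion is continuous off 0, and at 0 its value is 0 by convention. *)
Lemma measurable_invr (R : realType) : measurable_fun setT (@GRing.inv R).
Proof.
have m0 : measurable_fun setT (fun x : R => x == 0) by exact: measurable_fun_eqr.
rewrite (_ : @GRing.inv R = fun x => if x == 0 then 0 else x^-1); last first.
  by apply/funext => x; case: eqVneq => // ->; rewrite invr0.
apply: measurable_fun_if => //.
rewrite setTI (_ : _ @^-1` _ = [set x : R | x != 0]); last first.
  by apply/seteqP; split => x /=; case: eqVneq.
apply: open_continuous_measurable_fun.
  exact: open_neq.
by move=> x; rewrite inE /= => x0; exact: inv_continuous.
Qed.

Lemma measurable_funV d (T : measurableType d) (R : realType) (f : T -> R) :
  measurable_fun setT f -> measurable_fun setT (fun w => (f w)^-1).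
Proof. by move=> mf; exact: (measurableT_comp (@measurable_invr R) mf). Qed.

Section MeasurableMatrix.
Context {d : measure_display} {T : measurableType d} {R : realType}.

Definition measurable_mx n m (A : T -> 'M[R]_(n, m)) : Prop :=
  forall i j, measurable_fun setT (fun w => A w i j).

Lemma measurable_mx_cst n m (A : 'M[R]_(n, m)) : measurable_mx (fun _ => A).
Proof. by move=> i j; exact: measurable_cst. Qed.

Lemma measurable_mxD n m (A B : T -> 'M[R]_(n, m)) :
  measurable_mx A -> measurable_mx B -> measurable_mx (fun w => A w + B w).
Proof.
move=> mA mB i j; rewrite (_ : (fun w => _) = fun w => A w i j + B w i j).
  exact: measurable_funD.
by apply/funext => w; rewrite mxE.
Qed.

Lemma measurable_mxN n m (A : T -> 'M[R]_(n, m)) :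
  measurable_mx A -> measurable_mx (fun w => - A w).
Proof.
move=> mA i j; rewrite (_ : (fun w => _) = fun w => - A w i j).
  exact: measurable_funN.
by apply/funext => w; rewrite mxE.
Qed.

Lemma measurable_mxM n m p (A : T -> 'M[R]_(n, m)) (B : T -> 'M[R]_(m, p)) :
  measurable_mx A -> measurable_mx B -> measurable_mx (fun w => A w *m B w).
Proof.
move=> mA mB i j; rewrite (_ : (fun w => _) = fun w => \sum_k A w i k * B w k j).
  by apply: measurable_sum => k; exact: measurable_funM.
by apply/funext => w; rewrite mxE.
Qed.

Lemma measurable_mxZ n m (s : T -> R) (A : T -> 'M[R]_(n, m)) :
  measurable_fun setT s -> measurable_mx A -> measurable_mx (fun w => s w *: A w).
Proof.
move=> ms mA i j; rewrite (_ : (fun w => _) = fun w => s w * A w i j).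
  exact: measurable_funM.
by apply/funext => w; rewrite mxE.
Qed.

Lemma measurable_mxT n m (A : T -> 'M[R]_(n, m)) :
  measurable_mx A -> measurable_mx (fun w => (A w)^T).
Proof.
move=> mA i j; rewrite (_ : (fun w => _) = fun w => A w j i) //.
by apply/funext => w; rewrite mxE.
Qed.

Lemma measurable_det n (A : T -> 'M[R]_n) :
  measurable_mx A -> measurable_fun setT (fun w => \det (A w)).
Proof.
move=> mA; apply: measurable_sum => s; apply: measurable_funM => //.
by apply: measurable_prod => i _; exact: mA.
Qed.

Lemma measurable_adj n (A : T -> 'M[R]_n) :
  measurable_mx A -> measurable_mx (fun w => \adj (A w)).
Proof.
move=> mA i j; rewrite (_ : (fun w => _) = fun w => cofactor (A w) j i); last first.
  by apply/funext => w; rewrite mxE.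
apply: measurable_funM => //; apply: measurable_det => a b.
rewrite (_ : (fun w => _) = fun w => A w (lift j a) (lift i b)) //.
by apply/funext => w; rewrite !mxE.
Qed.

Lemma measurable_invmx n (A : T -> 'M[R]_n) :
  measurable_mx A -> measurable_mx (fun w => invmx (A w)).
Proof.
move=> mA i j; have mdet := measurable_det mA.
(* On singular matrices [invmx] is the identity map, so measurability needs a case split on the
   determinant. *)
rewrite (_ : (fun w => _) = fun w => if \det (A w) == 0 then A w i j
    else (\det (A w))^-1 * \adj (A w) i j); last first.
  apply/funext => w; rewrite /invmx unitmxE unitfE.
  by case: eqVneq => //= _; rewrite mxE.
apply: measurable_fun_ifT => //.
  exact: measurable_fun_eqr.
by apply: measurable_funM; [exact: measurable_funV|exact: measurable_adj].
Qed.

Lemma measurable_annih n k (A : T -> 'M[R]_(n, k)) :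
  measurable_mx A -> measurable_mx (fun w => annih (A w)).
Proof.
move=> mA; apply: measurable_mxD; first exact: measurable_mx_cst.
have mAt := measurable_mxT mA.
by apply/measurable_mxN/measurable_mxM => //; apply: measurable_mxM => //;
  apply/measurable_invmx/measurable_mxM.
Qed.
End MeasurableMatrix.

(** * The sigma-algebra generated by a random matrix *)

Section GeneratedByMatrix.
Context {R : realType} {d : measure_display} {Om : measurableType d} {n k : nat}.
Variable (A : Om -> 'M[R]_(n, k)).

(** These are the generators of [sigma_of_mx]. Placing their sigma-algebra on the carrier of [Om]
    turns measurability with respect to the regressors into ordinary measurability on [mx_space]. *)
Definition mx_events : set (set Om) :=
  [set E | exists (i : 'I_n) (j : 'I_k) (B : set R),
     measurable B /\ E = (fun w => A w i j) @^-1` B].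

Definition mx_space : measurableType _ := g_sigma_algebraType mx_events.

Lemma measurable_mx_space : measurable_mx (fun w : mx_space => A w).
Proof.
move=> i j _ B mB; rewrite setTI; apply: sub_sigma_algebra.
by exists i, j, B.
Qed.

Lemma measurable_to_mx_space : measurable_mx A ->
  measurable_fun setT (fun w : Om => w : mx_space).
Proof.
move=> mA _ B mB; rewrite setTI.
suff: <<s mx_events >> `<=` measurable by apply.
apply: smallest_sub; first exact: sigma_algebra_measurable.
move=> _ [i [j [C [mC ->]]]].
by rewrite -[X in measurable X]setTI; exact: mA.
Qed.
End GeneratedByMatrix.


(** * Tail bound at a fixed sample size *)

Section TailBound.
Context {R : realType} {d : measure_display} {Om : measurableType d}.
Context (P : probability Om R) {n k : nat}.
Variables (c C B eta : R) (X : Om -> 'M[R]_(n, k)) (eps : 'I_n.+1 -> Om -> R).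
Variables (kappa : Om -> probability R R) (al b : 'cV[R]_k).
Hypothesis c0 : 0 < c.
Hypothesis C0 : 0 < C.
Hypothesis B0 : 0 <= B.
Hypothesis eta0 : 0 < eta.
Hypothesis eta2 : eta <= 2^-1.
Hypothesis n0 : (0 < n)%N.
Hypothesis kn : k%:R / n%:R < 1 - c.
Hypothesis mX : measurable_mx X.
Hypothesis rX : forall w, \rank (X w) = k.
Hypothesis meps : forall t, measurable_fun setT (eps t).
Hypothesis iid : cond_iid P (sigma_of_mx X) eps kappa.
Hypothesis ae1 : {ae P, forall w, (\int[kappa w]_x x%:E = 0)%E}.
Hypothesis ae2 : {ae P, forall w, (c%:E < \int[kappa w]_x (x ^+ 2)%:E < C%:E)%E}.
Hypothesis ae4 : {ae P, forall w, (\int[kappa w]_x (x ^+ 4)%:E < C%:E)%E}.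

Let W := mx_space X.
Let pi : Om -> W := fun w => w.
Let kap : W -> probability R R := kappa.

Let mpi : measurable_fun setT pi.
Proof. exact: measurable_to_mx_space. Qed.

Let mkap D : measurable D -> measurable_fun setT (fun w => kap w D).
Proof.
move=> mD; rewrite (_ : (fun w => _) = EFin \o (fun w : W => fine (kappa w D))); last first.
  by apply/funext => w /=; rewrite fineK // fin_num_measure.
apply/measurable_EFinP => _ E mE; rewrite setTI.
exact: iid.1 mE.
Qed.

Let law (A : set W) (D : 'I_n.+1 -> set R) :
  measurable A -> (forall t, measurable (D t)) ->
  P ((pi @^-1` A) `&` [set w | forall t, D t (eps t w)])
  = (\int[P]_(w in pi @^-1` A) \prod_(t < n.+1) kap (pi w) (D t))%E.
Proof. by move=> mA mD; apply: iid.2. Qed.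

Let good : set W := [set w | [/\ (\int[kap w]_x x%:E = 0)%E,
  (c%:E < \int[kap w]_x (x ^+ 2)%:E < C%:E)%E & (\int[kap w]_x (x ^+ 4)%:E < C%:E)%E]].

Let mint j : measurable_fun setT (fun w => \int[kap w]_x (x ^+ j)%:E)%E.
Proof. by apply: measurable_cintegral => //; apply/measurable_EFinP. Qed.

Let mgood : measurable good.
Proof.
rewrite (_ : good = ((fun w => \int[kap w]_x (x ^+ 1)%:E)%E @^-1` [set 0%E])
  `&` ((fun w => \int[kap w]_x (x ^+ 2)%:E)%E @^-1` `]c%:E, C%:E[%classic)
  `&` ((fun w => \int[kap w]_x (x ^+ 4)%:E)%E @^-1` `]-oo, C%:E[%classic)).
  apply: measurableI; first apply: measurableI.
  - exact: measurable_preimT.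
  - by apply: measurable_preimT => //; exact: emeasurable_itv.
  - by apply: measurable_preimT => //; exact: emeasurable_itv.
by apply/seteqP; split => w /=; rewrite !in_itv /=; [case|case => -[]].
Qed.

Let good_ae : P (pi @^-1` (~` good)) = 0%E.
Proof.
apply/(measure_negligible (measurable_preimT mpi (measurableC mgood))).
have := negligibleU (negligibleU ae1 ae2) ae4; apply: negligibleS.
move=> w /= ng; apply: contrapT => /not_orP[/not_orP[h1 h2] h4]; apply: ng.
by split; exact: contrapT.
Qed.

Let tau (w : W) : R := pert_norm (X w) al.

Let mtau : measurable_fun setT tau.
Proof.
have mXW := @measurable_mx_space _ _ _ _ _ X.
have h : measurable_mx (fun w : W => al^T *m invmx ((X w)^T *m X w) *m al).
  apply: measurable_mxM; last exact: measurable_mx_cst.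
  apply: measurable_mxM; first exact: measurable_mx_cst.
  apply/measurable_invmx/measurable_mxM => //; exact: measurable_mxT.
exact: h.
Qed.

(** Both conditions depend on the regressors only, so [core] is an event of the conditioning
    sigma-algebra and its indicator is an admissible weight in the conditional inequalities. *)
Let core : set W := good `&` [set w | n%:R * tau w <= B].

Let mcore : measurable core.
Proof.
apply: measurableI => //.
rewrite (_ : mkset _ = (fun w => n%:R * tau w) @^-1` `]-oo, B]%classic); last first.
  by apply/seteqP; split => w /=; rewrite in_itv.
by apply: measurable_preimT => //; exact: measurable_funM.
Qed.

Let m : R := (n - k)%:R.

Let cm : c * n%:R < m.
Proof.
have n1 : 0 < n%:R :> R by rewrite ltr0n.
have h : k%:R < (1 - c) * n%:R by rewrite -ltr_pdivrMr.
(* Subtraction of naturals is truncated, so [k <= n] must be drawn from the ratio bound before [m]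
   can be read as a difference. *)
have kn' : (k <= n)%N.
  by rewrite -(ler_nat R); apply: ltW; apply: lt_le_trans h _; rewrite ler_piMl // gerBl ltW.
by rewrite /m natrB //; lra.
Qed.

Let m0 : 0 < m.
Proof. by apply: le_lt_trans cm; rewrite mulr_ge0 // ltW. Qed.

Let M (w : W) := annih (X w).

Let core_mom w : core w -> [/\ (\int[kap w]_x (x ^+ 4)%:E <= C%:E)%E,
  cpow kap w 1 = 0 & c < cpow kap w 2 < C].
Proof.
move=> [[g1 /andP[g2 g2'] g4] _]; split; first exact: ltW.
  rewrite /cpow /cmom; under eq_integral do rewrite expr1.
  by rewrite g1.
have fn : (\int[kap w]_x (x ^+ 2)%:E)%E \is a fin_num.
  rewrite ge0_fin_numE; first by apply: lt_trans g2' (ltry _).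
  by apply: integral_ge0 => x _; rewrite lee_fin sqr_ge0.
by rewrite /cpow /cmom -!lte_fin fineK // g2.
Qed.

Let core_mom2 w : core w -> 0 <= cpow kap w 2 <= C.
Proof. by move=> /core_mom[_ _ /andP[h1 h2]]; rewrite !ltW // (lt_trans c0). Qed.

Let x (w : Om) : 'cV[R]_n.+1 := \col_t eps t w.
(** [wd] selects the lagged errors, numbered 0 to [n - 1], and [lf] the current ones, numbered 1 to
    [n]. *)
Let wd : 'I_n -> 'I_n.+1 := widen_ord (leqnSn n).
Let lf : 'I_n -> 'I_n.+1 := lift ord0.

Let wdI : injective wd.
Proof. by move=> i j /(congr1 val) /= h; exact: val_inj. Qed.

Let lfI : injective lf. Proof. exact: lift_inj. Qed.

Let e w := selmx wd *m x w.
Let u w := selmx lf *m x w.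

Let quad_bad (f g : 'I_n -> 'I_n.+1) : set Om := pi @^-1` core `&`
  [set w | eta * m < `|((selmx f *m x w)^T *m M (pi w) *m (selmx g *m x w)) 0 0
     - cpow kap (pi w) 2 * \sum_i \sum_(j | g j == f i) M (pi w) i j|].

Let mM : measurable_mx (fun w : W => M w).
Proof. exact: (measurable_annih (@measurable_mx_space _ _ _ _ _ X)). Qed.

(** The squared norm of the embedded annihilator is its trace [m], so the bound is of order
    [m / (eta * m) ^+ 2], and [c * n < m] makes it of order [1 / n]. *)
Let quad_badP f g : injective f -> injective g ->
  measurable (quad_bad f g) /\
  (P (quad_bad f g) <= ((2 * C ^+ 2 + C) / (eta ^+ 2 * (c * n%:R)))%:E)%E.
Proof.
move=> fI gI.
pose Q w := pullmx f g (M w).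
have mQ : measurable_mx Q.
  apply: measurable_mxM; last exact: measurable_mx_cst.
  by apply: measurable_mxM => //; exact: measurable_mx_cst.
have -> : quad_bad f g = pi @^-1` core `&` [set w | eta * m <
     `|(\sum_p Q (pi w) p.1 p.2 * (eps p.1 w * eps p.2 w))
       - cpow kap (pi w) 2 * \tr (Q (pi w))|].
  have E w : ((selmx f *m x w)^T *m M (pi w) *m (selmx g *m x w)) 0 0
      = \sum_p Q (pi w) p.1 p.2 * (eps p.1 w * eps p.2 w).
    by rewrite pullmx_qform; apply: eq_bigr => p _; rewrite [x w p.1 0]mxE [x w p.2 0]mxE.
  by apply/seteqP; split => w [cw /= h]; split => //=; move: h; rewrite E pullmx_trace.
split.
  apply: measurableI; first exact: measurable_preimT.
  apply: measurable_norm_gt; apply: measurable_funB.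
    apply: measurable_sum => p; apply: measurable_funM; last exact: measurable_funM.
    by apply: (measurableT_comp (mQ p.1 p.2)).
  apply: measurable_funM.
    by apply: (measurableT_comp (measurable_cpow mkap 2)).
  by apply: measurable_sum => i; apply: (measurableT_comp (mQ i i)).
apply: (@le_trans _ _ ((2 * C ^+ 2 + C) * m / (eta * m) ^+ 2)%:E).
  apply: (quadratic_chebyshev mpi mkap meps law (Q := Q) mcore mQ) => //.
  - by rewrite mulr_gt0.
  - exact: ltW.
  - move=> w _; rewrite pullmx_sqnorm // annih_sym annih_idem // annih_trace // /m natrB //.
    by have := rX w => <-; exact: rank_leq_row.
  - by move=> w /core_mom[].
  - by move=> w /core_mom[].
rewrite lee_fin; have -> : (2 * C ^+ 2 + C) * m / (eta * m) ^+ 2 = (2 * C ^+ 2 + C) / (eta ^+ 2 * m).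
  by field; rewrite !gt_eqF.
rewrite ler_wpM2l ?addr_ge0 ?mulr_ge0 ?sqr_ge0 ?(ltW C0) //.
have cn0 : 0 < c * n%:R by rewrite mulr_gt0 // ltr0n.
have e2 : 0 < eta ^+ 2 by rewrite exprn_gt0.
rewrite lef_pV2 ?posrE ?(mulr_gt0 e2 cn0) ?(mulr_gt0 e2 m0) //.
by rewrite ler_wpM2l ?sqr_ge0 // ltW.
Qed.

Let q (w : W) := pert_dir (X w) al.

Let mq : measurable_mx q.
Proof.
have mXW := @measurable_mx_space _ _ _ _ _ X.
apply: measurable_mxM; last exact: measurable_mx_cst.
apply: measurable_mxM => //.
by apply/measurable_invmx/measurable_mxM => //; exact: measurable_mxT.
Qed.

Let lin_bad (f : 'I_n -> 'I_n.+1) : set Om := pi @^-1` core `&`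
  [set w | eta < `|((q (pi w))^T *m (selmx f *m x w)) 0 0|].

Let lin_badP f : injective f ->
  measurable (lin_bad f) /\
  (P (lin_bad f) <= (C * (B / n%:R) / eta ^+ 2)%:E)%E.
Proof.
move=> fI; pose v w a := ((q w)^T *m selmx f) 0 a.
have mv : forall a, measurable_fun setT (fun w => v w a).
  move=> a; have h : measurable_mx (fun w => (q w)^T *m selmx f).
    by apply: measurable_mxM; [exact: measurable_mxT|exact: measurable_mx_cst].
  exact: h.
have -> : lin_bad f = pi @^-1` core `&` [set w | eta < `|\sum_a v (pi w) a * eps a w|].
  have E w : ((q (pi w))^T *m (selmx f *m x w)) 0 0 = \sum_a v (pi w) a * eps a w.
    by rewrite mulmxA mxE; apply: eq_bigr => a _; rewrite [x w a 0]mxE.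
  by apply/seteqP; split => w [cw /= h]; split => //=; move: h; rewrite E.
split.
  apply: measurableI; first exact: measurable_preimT.
  apply: measurable_norm_gt; apply: measurable_sum => a; apply: measurable_funM => //.
  by apply: (measurableT_comp (mv a)).
apply: (linear_chebyshev mpi mkap meps law mcore mv) => //.
- by rewrite divr_ge0.
- exact: ltW.
- move=> w [_ /= tB].
  (* Selection by an injection preserves norms, so the coefficients have squared norm q'q = [tau],
     at most [B / n] on [core]. *)
  have -> : \sum_a v w a ^+ 2 = tau w.
    have <- : (((q w)^T *m selmx f) *m ((q w)^T *m selmx f)^T) 0 0 = tau w.
      rewrite (trmx_mul (q w)^T) (trmxK (q w)) mulmxA -(mulmxA _ (selmx f)) selmx_inj // mulmx1.
      by rewrite pert_dir_sqnorm // mxE.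
    by rewrite mxE; apply: eq_bigr => a _; rewrite [X in _ = _ * X]mxE expr2.
  by rewrite ler_pdivlMr ?ltr0n // mulrC.
- by move=> w /core_mom[].
- by move=> w /core_mom[].
Qed.

Let Z (w : Om) : R :=
  let Xa : 'M[R]_(n, k) := X w + \matrix_(i, j) (eps (widen_ord (leqnSn n) i) w * al j ord0) in
  let y : 'cV[R]_n := Xa *m b + \col_i eps (lift ord0 i) w in
  let sig2hat : R := (y^T *m annih Xa *m y) ord0 ord0 / (n - k)%:R in
  let sig2 : R := fine (\int[kappa w]_x (x ^+ 2)%:E)%E in
  let Sbar : 'M[R]_k := (X w)^T *m X w + (sig2 * (n - k)%:R) *: (al *m al^T) in
  let Mt : 'M[R]_n := annih (X w) in
  let S : R := \sum_(i < n) \sum_(j < n | j.+1 == i) Mt i j in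
  sig2hat / sig2
  - (1 - sig2 * (al^T *m invmx Sbar *m al) ord0 ord0 / (n - k)%:R * S ^+ 2).

Let leverage (w : Om) : R :=
  (al^T *m invmx ((n%:R)^-1 *: ((X w)^T *m X w)) *m al) ord0 ord0.

Let leverageE w : leverage w = n%:R * tau w.
Proof.
have n1 : n%:R != 0 :> R by rewrite pnatr_eq0 -lt0n.
rewrite /leverage invmxZ ?unitmxZ ?unitfE ?invr_eq0 ?gram_unitmx //.
by rewrite invrK -scalemxAr -scalemxAl mxE.
Qed.

Let mleverage : measurable_fun setT leverage.
Proof.
rewrite (_ : leverage = fun w => n%:R * tau (pi w)); last by apply/funext => w; exact: leverageE.
by apply: measurable_funM => //; exact: measurableT_comp.
Qed.

Let mZ : measurable_fun setT Z.
Proof.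
have ms : measurable_fun setT (fun w => fine (\int[kappa w]_x (x ^+ 2)%:E)%E).
  by apply: (measurableT_comp (measurable_cpow mkap 2)).
have mXt := measurable_mxT mX.
have mXX := measurable_mxM mXt mX.
have mXa : measurable_mx (fun w => X w + \matrix_(i, j) (eps (widen_ord (leqnSn n) i) w * al j ord0)).
  apply: measurable_mxD => // i j.
  rewrite (_ : (fun w => _) = fun w => eps (widen_ord (leqnSn n) i) w * al j ord0).
    exact: measurable_funM.
  by apply/funext => w; rewrite mxE.
have my : measurable_mx (fun w => (X w + \matrix_(i, j) (eps (widen_ord (leqnSn n) i) w * al j ord0)) *m b
    + \col_i eps (lift ord0 i) w).
  apply: measurable_mxD; first by apply: measurable_mxM => //; exact: measurable_mx_cst.
  move=> i j; rewrite (_ : (fun w => _) = fun w => eps (lift ord0 i) w) //.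
  by apply/funext => w; rewrite mxE.
have mq1 := measurable_mxM (measurable_mxM (measurable_mxT my) (measurable_annih mXa)) my.
have mS : measurable_fun setT (fun w => \sum_(i < n) \sum_(j < n | j.+1 == i) annih (X w) i j).
  apply: measurable_sum => i; under eq_fun do rewrite big_mkcond.
  by apply: measurable_sum => j; case: (_ == _) => //; exact: (measurable_annih mX).
have mSb : measurable_mx (fun w => (X w)^T *m X w
    + (fine (\int[kappa w]_x (x ^+ 2)%:E)%E * (n - k)%:R) *: (al *m al^T)).
  apply: measurable_mxD => //; apply: measurable_mxZ; last exact: measurable_mx_cst.
  exact: measurable_funM.
have mq2 := measurable_mxM (measurable_mxM (measurable_mx_cst al^T) (measurable_invmx mSb))
  (measurable_mx_cst al).
apply: measurable_funB.
  apply: measurable_funM; last exact: measurable_funV.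
  by apply: measurable_funM => //; exact: mq1.
apply: measurable_funB => //; apply: measurable_funM; last exact: measurable_funX.
apply: measurable_funM => //; apply: measurable_funM => //; exact: mq2.
Qed.

Let gap_subset : [set w | err_const c C B c^-1 * eta < `|Z w|] `<=`
  pi @^-1` (~` good) `|` [set w | B < `|leverage w|] `|` quad_bad lf lf `|` quad_bad wd wd
  `|` quad_bad wd lf `|` lin_bad lf `|` lin_bad wd.
Proof.
move=> w /= gap; apply: contrapT => /not_orP[/not_orP[/not_orP[/not_orP[/not_orP[/not_orP[
  h1 h2] h3] h4] h5] h6] h7].
have gw : good w by apply: contrapT.
have tw : n%:R * tau w <= B.
  by rewrite -leverageE; apply: le_trans (ler_norm _) _; rewrite leNgt; exact/negP.
have cw : core w by [].
have nq f g : ~ quad_bad f g w ->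
    `|((selmx f *m x w)^T *m M w *m (selmx g *m x w)) 0 0
      - cpow kap w 2 * \sum_i \sum_(j | g j == f i) M w i j| <= eta * m.
  by move=> h; rewrite leNgt; apply/negP => hw; apply: h; split.
have nl f : ~ lin_bad f w -> `|((q w)^T *m (selmx f *m x w)) 0 0| <= eta.
  by move=> h; rewrite leNgt; apply/negP => hw; apply: h; split.
have trM : \tr (M w) = m.
  rewrite annih_trace // /m natrB //.
  by rewrite -[X in (X <= _)%N](rX w); exact: rank_leq_row.
have S1 f : injective f -> \sum_i \sum_(j | f j == f i :> 'I_n.+1) M w i j = m.
  move=> fI; rewrite -trM; apply: eq_bigr => i _.
  by rewrite (big_pred1 i) // => j; rewrite (inj_eq fI).
(* Row [j] of the current errors is error number [j + 1] and row [i] of the lagged ones is number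
   [i]; they agree exactly on the subdiagonal. *)
have S2 : \sum_i \sum_(j | lf j == wd i) M w i j = \sum_(i < n) \sum_(j < n | j.+1 == i) M w i j.
  by apply: eq_bigr => i _; apply: eq_bigl => j; rewrite -val_eqE.
have [_ _ s2] := core_mom cw.
move/nq: h3; rewrite (S1 _ lfI) => h3; move/nq: h4; rewrite (S1 _ wdI) => h4.
move/nq: h5; rewrite S2 => h5; move/nl: h6 => h6; move/nl: h7 => h7.
have eta02 : 0 <= eta <= 2^-1 by rewrite (ltW eta0).
have := resid_ratio_error b c0 s2 B0 eta02 (rX w) cm tw h3 h4 h5 h6 h7.
move=> h; suff: `|Z w| <= err_const c C B c^-1 * eta by rewrite leNgt gap.
have eE : \matrix_(i, j) (eps (widen_ord (leqnSn n) i) w * al j ord0) = e w *m al^T.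
  by apply/matrixP => i j; rewrite [RHS]mxE big_ord1 selmx_mul !mxE.
have uE : \col_i eps (lift ord0 i) w = u w.
  by apply/matrixP => i j; rewrite selmx_mul !mxE.
by rewrite /Z /= eE uE; exact: h.
Qed.

(** A union bound over a null event, the leverage event, three quadratic forms and two linear ones.
    [B1] is kept apart from [B] because the constant supplied by boundedness in probability may be
    negative. *)
Lemma resid_ratio_tail (e0 B1 : R) : err_const c C B c^-1 * eta <= e0 -> B1 <= B ->
  (P [set w | (e0 < `|Z w|)%R]
   <= P [set w | (B1 < `|leverage w|)%R]
      + ((3 * ((2 * C ^+ 2 + C) / (eta ^+ 2 * (c * n%:R)))
          + 2 * (C * (B / n%:R) / eta ^+ 2)))%:E)%E.
Proof.
move=> e0E B1B; have [m1 b1] := quad_badP lfI lfI; have [m2 b2] := quad_badP wdI wdI.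
have [m3 b3] := quad_badP wdI lfI.
have [m4 b4] := lin_badP lfI; have [m5 b5] := lin_badP wdI.
have mg : measurable (pi @^-1` (~` good)) by apply: measurable_preimT => //; exact: measurableC.
have ml : measurable [set w | B < `|leverage w|] by exact: measurable_norm_gt.
have ml1 : measurable [set w | B1 < `|leverage w|] by exact: measurable_norm_gt.
have mgap : measurable [set w | e0 < `|Z w|] by exact: measurable_norm_gt.
have PU (E F : set Om) (a1 a2 : \bar R) : measurable E -> measurable F ->
    (P E <= a1)%E -> (P F <= a2)%E -> (P (E `|` F) <= a1 + a2)%E.
  by move=> mE mF Ex Fy; apply: le_trans (measureU2 _ mE mF) _; exact: leeD.
apply: (@le_trans _ _ (P (pi @^-1` (~` good) `|` [set w | (B < `|leverage w|)%R] `|` quad_bad lf lf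
  `|` quad_bad wd wd `|` quad_bad wd lf `|` lin_bad lf `|` lin_bad wd))).
  apply: le_measure; rewrite ?inE //.
    by do 6 apply: measurableU => //.
  by move=> w /= hw; apply: gap_subset; exact: le_lt_trans hw.
set a := (2 * C ^+ 2 + C) / _; set l := C * (B / _) / _.
have -> : (3 * a + 2 * l)%:E = (a%:E + a%:E + a%:E + l%:E + l%:E)%E.
  by rewrite -!EFinD; congr EFin; ring.
rewrite !addeA; do 5 (apply: (@PU) => //; try by do ?apply: measurableU).
rewrite -[leRHS]add0e; apply: (@PU) => //; first by rewrite good_ae.
by apply: le_measure; rewrite ?inE // => w /=; exact: le_lt_trans.
Qed.
End TailBound.

(** * Passage to the limit in probability *)

Theorem theorem2 (R : realType) (d : measure_display) (Om : nat -> measurableType d)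
  (P : forall T : nat, probability (Om T) R)
  (K : nat -> nat) (c C : R)
  (Xt : forall T : nat, Om T -> 'M[R]_(T, K T))
  (eps : forall T : nat, 'I_T.+1 -> Om T -> R)
  (kappa : forall T : nat, Om T -> probability R R)
  (alpha beta r : forall T : nat, 'cV[R]_(K T)) :
  0 < c < 1 -> 0 < C ->
  (* (i) *)
  (forall T (i : 'I_T) (j : 'I_(K T)), measurable_fun setT (fun w => Xt T w i j)) ->
  (forall T w, \rank (Xt T w) = K T) ->
  (* (ii) *)
  (forall T (t : 'I_T.+1), measurable_fun setT (eps T t)) ->
  (forall T, cond_iid (P T) (sigma_of_mx (Xt T)) (eps T) (kappa T)) ->
  (forall T, {ae P T, forall w, (\int[kappa T w]_x x%:E = 0)%E}) ->
  (forall T, {ae P T, forall w,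
      (c%:E < \int[kappa T w]_x (x ^+ 2)%:E < C%:E)%E}) ->
  (forall T, {ae P T, forall w, (\int[kappa T w]_x (x ^+ 4)%:E < C%:E)%E}) ->
  (* (iii) *)
  Op1 P (fun T w =>
    ((alpha T)^T *m invmx ((T%:R)^-1 *: ((Xt T w)^T *m Xt T w)) *m alpha T) ord0 ord0) ->
  Op1 P (fun T w =>
    ((r T)^T *m invmx ((T%:R)^-1 *: ((Xt T w)^T *m Xt T w)) *m r T) ord0 ord0) ->
  (* (iv) *)
  (forall T, (K T)%:R / T%:R < 1 - c) ->
  op1 P (fun T w =>
    let X : 'M[R]_(T, K T) :=
      Xt T w + \matrix_(i, j) (eps T (widen_ord (leqnSn T) i) w * alpha T j ord0) in
    let y : 'cV[R]_T :=
      X *m beta T + \col_i eps T (lift ord0 i) w in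
    let sig2hat : R := (y^T *m annih X *m y) ord0 ord0 / (T - K T)%:R in
    let sig2 : R := fine (\int[kappa T w]_x (x ^+ 2)%:E)%E in
    let Sbar : 'M[R]_(K T) :=
      (Xt T w)^T *m Xt T w + (sig2 * (T - K T)%:R) *: (alpha T *m (alpha T)^T) in
    let Mt : 'M[R]_T := annih (Xt T w) in
    let S : R := \sum_(i < T) \sum_(j < T | j.+1 == i) Mt i j in
    sig2hat / sig2
    - (1 - sig2 * ((alpha T)^T *m invmx Sbar *m alpha T) ord0 ord0 / (T - K T)%:R
             * S ^+ 2)).
Proof.
move=> /andP[c0 c1] C0 mX rX meps iid ae1 ae2 ae4 lev _ hK e delta e0 delta0.
have d2 : 0 < delta / 2 by rewrite divr_gt0.
have [M0 [N0 levN]] := lev _ d2.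
pose B := Num.max M0 0.
have B0 : 0 <= B by rewrite le_max lexx orbT.
have MB : M0 <= B by rewrite le_max lexx.
pose k0 := err_const c C B c^-1.
have k1 : 0 < `|k0| + 1 by rewrite ltr_wpDl.
(* The first entry keeps the denominator away from 0, the second brings the deterministic error
   below [e]; adding 1 avoids a division by 0. *)
pose eta := Num.min 2^-1 (e / (`|k0| + 1)).
have eta0 : 0 < eta by rewrite lt_min invr_gt0 ltr0n divr_gt0.
have eta2 : eta <= 2^-1 by rewrite ge_min lexx.
have etae : k0 * eta <= e.
  apply: (@le_trans _ _ ((`|k0| + 1) * eta)).
    rewrite ler_wpM2r ?(ltW eta0) //; apply: le_trans (ler_norm _) _.
    by rewrite lerDl.
  by rewrite mulrC -ler_pdivlMr // ge_min lexx orbT.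
(* The three quadratic and two linear bounds add up to [H / T]. Half of [delta] is spent on the
   leverage event, the other half is met once [T] exceeds [H / (delta / 2)]. *)
pose H := 3 * (2 * C ^+ 2 + C) / (eta ^+ 2 * c) + 2 * C * B / eta ^+ 2.
have H0 : 0 <= H.
  by rewrite addr_ge0 // divr_ge0 ?mulr_ge0 ?addr_ge0 ?mulr_ge0 ?sqr_ge0 // ltW.
exists (maxn N0 (Num.bound (H / (delta / 2)))) => T.
rewrite geq_max => /andP[NT HT].
have HTlt : H / (delta / 2) < T%:R.
  apply: lt_le_trans (archi_boundP _) _; first by rewrite divr_ge0 // ltW.
  by rewrite ler_nat.
have T0 : 0 < T%:R :> R by apply: le_lt_trans HTlt; rewrite divr_ge0 // ltW.
have T1 : (0 < T)%N by rewrite -(ltr0n R).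
have tail := resid_ratio_tail (alpha T) (beta T) c0 C0 B0 eta0 eta2 T1 (hK T) (mX T)
  (rX T) (meps T) (iid T) (ae1 T) (ae2 T) (ae4 T) etae MB.
apply: le_trans tail _.
have -> : delta%:E = ((delta / 2)%:E + (delta / 2)%:E)%E.
  by rewrite -EFinD; congr EFin; field.
apply: leeD; first exact: levN.
rewrite lee_fin.
have -> : 3 * ((2 * C ^+ 2 + C) / (eta ^+ 2 * (c * T%:R))) + 2 * (C * (B / T%:R) / eta ^+ 2)
    = H / T%:R by rewrite /H; field; rewrite !gt_eqF.
by rewrite ler_pdivrMr // mulrC -ler_pdivrMr // ltW.
Qed.
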